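(* Let $\mathbb{K}\in\{\mathbb{R},\mathbb{C}\}$ and let $\Omega\in\mathbb{K}^{n\times\ell}$ be a full-rank random embedding such that $\Omega\sim U\Omega$ for each unitary $U\in\mathbb{K}^{n\times n}$. For any $A\in\mathbb{K}^{d\times n}$ that satisfies $r:=\operatorname{rank}(A)\ge\ell$, $$\mathbb{E}\,\|A-\Pi_{A\Omega}A\|_{\rm F}^2\ \le\ \min_{q<\ell-\alpha_{\mathbb{K}}}\ \frac{r-\ell}{r-q}\left(1+\frac{q}{\ell-q-\alpha_{\mathbb{K}}}\right)\|A-[\![A]\!]_q\|_{\rm F}^2,$$ where the minimum is over nonnegative integers $q$ with $q<\ell-\alpha_{\mathbb{K}}$.
   Context: $\mathbb{K}$ is the field of real or complex numbers, and $\alpha_{\mathbb{K}}=1$ if $\mathbb{K}=\mathbb{R}$, $\alpha_{\mathbb{K}}=0$ if $\mathbb{K}=\mathbb{C}$. $\|\cdot\|_{\rm F}$ is the Frobenius norm. All matrix dimensions are positive integers. An embedding is a matrix in $\mathbb{K}^{n\times\ell}$ with $n\ge\ell$; a random embedding is full-rank if its rank is $\ell$ (with probability one). $\sim$ denotes equality in distribution; ''unitary'' over $\mathbb{R}$ means orthogonal. $\Pi_F$ denotes the orthogonal projection onto the range of a matrix $F$; $\Pi_{A\Omega}A$ is the randomized SVD approximation of $A$. $[\![A]\!]_q$ denotes an optimal rank-$q$ approximation of $A$, given by any $q$-truncated singular value decomposition. A minimum over an empty set is $+\infty$. *)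

(* Defs.v *)
From HB Require Import structures.
From mathcomp Require Import all_boot all_order all_algebra.
From mathcomp Require Import all_classical all_reals all_analysis.
From mathcomp.real_closed Require Import complex.

Set Implicit Arguments.
Unset Strict Implicit.
Unset Printing Implicit Defensive.

Import Order.TTheory GRing.Theory Num.Theory.
Import numFieldNormedType.Exports.

Local Open Scope classical_set_scope.
Local Open Scope ring_scope.

Variant scalars := RealScalars | ComplexScalars.

Definition fieldK (R : realType) (k : scalars) : numFieldType :=
  match k with
  | RealScalars => R : numFieldType
  | ComplexScalars => R[i] : numFieldType
  end.

Definition alphaK (k : scalars) : nat :=
  match k with RealScalars => 1 | ComplexScalars => 0 end.

Definition ofRealK (R : realType) (k : scalars) : R -> fieldK R k :=
  match k with
  | RealScalars => fun x => x
  | ComplexScalars => fun x => (x%:C)%C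
  end.

Definition conjK (R : realType) (k : scalars) : fieldK R k -> fieldK R k :=
  match k with
  | RealScalars => fun x => x
  | ComplexScalars => fun z => (z^*)%C
  end.

(* The library's [`|z|] on [R[i]] takes its values in [R[i]]. *)
Definition absK (R : realType) (k : scalars) : fieldK R k -> R :=
  match k with
  | RealScalars => fun x => `|x|
  | ComplexScalars => fun z => complex.Re `|z|
  end.

Definition adjmx (R : realType) (k : scalars) (m n : nat)
    (M : 'M[fieldK R k]_(m, n)) : 'M[fieldK R k]_(n, m) :=
  map_mx (@conjK R k) M^T.

Definition is_unitaryK (R : realType) (k : scalars) (n : nat)
    (U : 'M[fieldK R k]_n) : Prop :=
  U *m adjmx U = 1%:M.

Definition frobenius (R : realType) (k : scalars) (m n : nat)
    (M : 'M[fieldK R k]_(m, n)) : R :=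
  Num.sqrt (\sum_i \sum_j absK (M i j) ^+ 2).

(* The library works with row spaces.  The range of [F] is the row space of
   [F^T], and its orthogonal complement consists of the [x] with
   [adjmx F *m x = 0], that is (transposing) [x^T *m map_mx conjK F = 0].
   [proj_mx] projects onto the first along the second, acting on rows, so the
   final transposition gives the projector acting on columns. *)
Definition orthoproj (R : realType) (k : scalars) (m n : nat)
    (F : 'M[fieldK R k]_(m, n)) : 'M[fieldK R k]_m :=
  (proj_mx <<F^T>>%MS (kermx (map_mx (@conjK R k) F)))^T.

Definition rect_diag (R : realType) (k : scalars) (m n : nat) (s : nat -> R) :
    'M[fieldK R k]_(m, n) :=
  \matrix_(i < m, j < n) (if i == j :> nat then ofRealK k (s i) else 0).

(* Only the values [s i] with [i < minn m n] matter. *)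
Definition is_svd (R : realType) (k : scalars) (m n : nat)
    (A : 'M[fieldK R k]_(m, n))
    (U : 'M[fieldK R k]_m) (s : nat -> R) (V : 'M[fieldK R k]_n) : Prop :=
  [/\ is_unitaryK U, is_unitaryK V,
      forall i, 0 <= s i,
      forall i j, (i <= j)%N -> s j <= s i
    & A = U *m rect_diag k m n s *m adjmx V].

Definition is_truncated_svd (R : realType) (k : scalars) (m n : nat) (q : nat)
    (A B : 'M[fieldK R k]_(m, n)) : Prop :=
  exists U s V, is_svd A U s V /\
    B = U *m rect_diag k m n (fun i => if (i < q)%N then s i else 0)
          *m adjmx V.

Definition borelmx (R : realType) (k : scalars) (m n : nat) :=
  g_sigma_algebraType (@open 'M[fieldK R k]_(m, n)).

Definition eq_in_distribution (d d' : measure_display)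
    (T : measurableType d) (T' : measurableType d') (R : realType)
    (P : probability T R) (X Y : T -> T') : Prop :=
  forall B : set T', measurable B -> pushforward P X B = pushforward P Y B.

(* Main.v *)
(** Proof idea.  Write [A = U S V*] and let [X] be the first [r] rows of [V* Omega],
    a random matrix invariant under rotations of [K^r] and of rank [l] almost surely.
    For every matrix [Z], the error is at most the squared norm of [S (1 - X Z)], so an
    upper bound follows from a good choice of [E = 1 - X Z].  For [q = 0] take the
    orthogonal projector [E] onto the complement of the range of [X]; then kill the rows
    [0, ..., q - 1] of [E] one at a time, subtracting [u (e_j* E) / u_j] where [u] is the
    projection of [e_j] onto the vectors of the range of [X] which vanish on the
    preceding coordinates.  Let [P] be that projector and [M = E E*].  Each step adds
    [M_jj / P_jj] to the trace of [M].

    By invariance the expected derivative of [Re (w P_ji) M_jj / P_jj] along rotations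
    of the plane [(e_i, e_j)] vanishes; summing over [i] and over the phases [w] gives
    [E (M_jj / P_jj) = E (tr M) / (p - 1 - alpha)] with [p = tr P], so that the expected
    trace grows by the factor [(p - alpha) / (p - 1 - alpha)] and telescopes to
    [(r - l) (l - alpha) / (l - q - alpha)].  The remaining [r - q] rows have equal
    expected norms, whence the factor [1 / (r - q)].

    Denominators are regularized as [P_jj + eps], which makes all random variables
    bounded; the rows that should vanish are then [O(eps)] in expectation. *)

From HB Require Import structures.
Require Import Defs.
From mathcomp Require Import all_boot all_order all_algebra.
From mathcomp Require Import all_classical all_reals all_analysis.
From mathcomp Require Import measurable_realfun.
From mathcomp.real_closed Require Import complex.
From mathcomp Require Import ring lra.

Set Implicit Arguments.
Unset Strict Implicit.
Unset Printing Implicit Defensive.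

Import Order.TTheory GRing.Theory Num.Theory.
Import numFieldNormedType.Exports.

Local Open Scope ring_scope.

(** * Real and complex scalars *)

Section Scalars.
Context (R : realType) (k : scalars).
Local Notation K := (fieldK R k).

Definition reK : K -> R :=
  match k return fieldK R k -> R with
  | RealScalars => fun x => x
  | ComplexScalars => fun z => complex.Re z
  end.

Definition imK : K -> R :=
  match k return fieldK R k -> R with
  | RealScalars => fun=> 0
  | ComplexScalars => fun z => complex.Im z
  end.

Definition normK2 (z : K) : R := reK z ^+ 2 + imK z ^+ 2.

(** Directions of rotation: each coordinate plane is turned once per phase, which is how the number
    [2 - alphaK k] enters the constants. *)
Definition phasesK : seq K :=
  match k return seq (fieldK R k) with
  | RealScalars => [:: 1]
  | ComplexScalars => [:: 1; 'i%C]
  end.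

Local Notation "x %:K" := (@ofRealK R k x) (at level 2, format "x %:K").
Local Notation conj := (@conjK R k).

Fact ofRealK_is_zmod : zmod_morphism (@ofRealK R k).
Proof. by case: k => //= x y; rewrite -rmorphB. Qed.
Fact ofRealK_is_monoid : monoid_morphism (@ofRealK R k).
Proof. by case: k => //=; split => // x y; rewrite -rmorphM. Qed.
HB.instance Definition _ := GRing.isZmodMorphism.Build R K (@ofRealK R k) ofRealK_is_zmod.
HB.instance Definition _ := GRing.isMonoidMorphism.Build R K (@ofRealK R k) ofRealK_is_monoid.

Fact conjK_is_zmod : zmod_morphism conj.
Proof. by case: k => //= x y; rewrite rmorphB. Qed.
Fact conjK_is_monoid : monoid_morphism conj.
Proof. by case: k => //=; split=> [|x y]; rewrite ?rmorph1 ?rmorphM. Qed.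
HB.instance Definition _ := GRing.isZmodMorphism.Build K K conj conjK_is_zmod.
HB.instance Definition _ := GRing.isMonoidMorphism.Build K K conj conjK_is_monoid.

Fact reK_is_zmod : zmod_morphism reK.
Proof. by rewrite /reK; case: k => //= [[? ?] [? ?]]. Qed.
HB.instance Definition _ := GRing.isZmodMorphism.Build K R reK reK_is_zmod.
Fact imK_is_zmod : zmod_morphism imK.
Proof. by rewrite /imK; case: k => //= [x y|[? ?] [? ?]]; rewrite ?subr0. Qed.
HB.instance Definition _ := GRing.isZmodMorphism.Build K R imK imK_is_zmod.

Lemma conjKK : involutive conj.
Proof. by case: k => //= -[a b] /=; rewrite opprK. Qed.

Lemma conjK_ofReal x : conj x%:K = x%:K.
Proof. by case: k => //=; rewrite oppr0. Qed.

Lemma reK_ofReal x : reK x%:K = x.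
Proof. by rewrite /reK; case: k. Qed.

Lemma imK_ofReal x : imK x%:K = 0.
Proof. by rewrite /imK; case: k. Qed.

Lemma reK_conj z : reK (conj z) = reK z.
Proof. by rewrite /reK; case: k z => //= -[]. Qed.

Lemma imK_conj z : imK (conj z) = - imK z.
Proof. by rewrite /imK; case: k z => //= [_|[]//]; rewrite oppr0. Qed.

Lemma reKM y z : reK (y * z) = reK y * reK z - imK y * imK z.
Proof. by rewrite /reK /imK; case: k y z => //= [y z|[? ?] [? ?]//]; rewrite mul0r subr0. Qed.

Lemma imKM y z : imK (y * z) = reK y * imK z + imK y * reK z.
Proof. by rewrite /reK /imK; case: k y z => //= [y z|[? ?] [? ?]//]; rewrite mul0r mulr0 addr0. Qed.

Lemma eqK (y z : K) : reK y = reK z -> imK y = imK z -> y = z.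
Proof. by rewrite /reK /imK; case: k y z => //= -[a b] [c e] /= -> ->. Qed.

Lemma reK_ofRealM x z : reK (x%:K * z) = x * reK z.
Proof. by rewrite reKM reK_ofReal imK_ofReal mul0r subr0. Qed.

Lemma mul_conjK (z : K) : z * conj z = (normK2 z)%:K.
Proof.
apply: eqK; rewrite ?reKM ?imKM ?reK_ofReal ?imK_ofReal ?reK_conj ?imK_conj /normK2; ring.
Qed.

Lemma absK_sqr (z : K) : absK z ^+ 2 = normK2 z.
Proof.
rewrite /normK2 /reK /imK; case: k z => /= [x|[a b] /=].
  by rewrite real_normK ?num_real // expr0n addr0.
by rewrite sqr_sqrtr // addr_ge0 // sqr_ge0.
Qed.

Lemma normK2_ge0 z : 0 <= normK2 z.
Proof. by rewrite addr_ge0 // sqr_ge0. Qed.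

Lemma normK2_eq0 z : normK2 z = 0 -> z = 0.
Proof.
move/eqP; rewrite paddr_eq0 ?sqr_ge0 // !sqrf_eq0 => /andP[/eqP a0 /eqP b0].
by apply: eqK; rewrite ?a0 ?b0 ?raddf0.
Qed.

Lemma normK2M y z : normK2 (y * z) = normK2 y * normK2 z.
Proof. rewrite /normK2 reKM imKM; ring. Qed.

Lemma normK2_ofReal x : normK2 x%:K = x ^+ 2.
Proof. by rewrite /normK2 reK_ofReal imK_ofReal expr0n addr0. Qed.

Lemma size_phasesK : size phasesK = (2 - alphaK k)%N.
Proof. by rewrite /phasesK; case: k. Qed.

Lemma normK2_phase w : w \in phasesK -> normK2 w = 1.
Proof.
rewrite /normK2 /reK /imK; rewrite /phasesK; case: k w => /= w; rewrite !inE.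
  by move/eqP->; rewrite expr0n addr0 expr1n.
by case/orP=> /eqP-> /=; rewrite ?expr0n /= ?expr1n ?addr0 ?add0r.
Qed.

Lemma one_phasesK : 1 \in phasesK.
Proof. by rewrite /phasesK; case: k; rewrite inE eqxx. Qed.

(* The phases are an orthonormal basis of [K] over the reals. *)
Lemma sum_phasesK y z :
  \sum_(w <- phasesK) reK (w * y) * reK (w * z) = reK (y * conj z).
Proof.
rewrite /reK /phasesK; case: k y z => /= [y z|[a b] [c e]].
  by rewrite big_seq1 !mul1r.
rewrite big_cons big_seq1 /=; ring.
Qed.

End Scalars.

(** * Hermitian projectors *)

Section Matrices.
Context (R : realType) (k : scalars).
Local Notation K := (fieldK R k).
Local Notation "x %:K" := (@ofRealK R k x) (at level 2, format "x %:K").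
Local Notation adj := (@adjmx R k _ _).

Lemma adjmxE m n (A : 'M[K]_(m, n)) i j : adj A i j = conjK (A j i).
Proof. by rewrite !mxE. Qed.

Lemma adjmxK m n (A : 'M[K]_(m, n)) : adj (adj A) = A.
Proof. by apply/matrixP => i j; rewrite !adjmxE conjKK. Qed.

Lemma adjmxM m n p (A : 'M[K]_(m, n)) (B : 'M[K]_(n, p)) :
  adj (A *m B) = adj B *m adj A.
Proof. by rewrite /adjmx trmx_mul map_mxM. Qed.

Lemma adjmxD m n (A B : 'M[K]_(m, n)) : adj (A + B) = adj A + adj B.
Proof. by apply/matrixP => i j; rewrite !mxE rmorphD. Qed.

Lemma adjmxB m n (A B : 'M[K]_(m, n)) : adj (A - B) = adj A - adj B.
Proof. by apply/matrixP => i j; rewrite !mxE rmorphB. Qed.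

Lemma adjmxZ m n (a : K) (A : 'M[K]_(m, n)) : adj (a *: A) = conjK a *: adj A.
Proof. by apply/matrixP => i j; rewrite !mxE rmorphM. Qed.

Lemma adjmx1 n : adj (1%:M : 'M[K]_n) = 1%:M.
Proof. by apply/matrixP => i j; rewrite !mxE eq_sym rmorph_nat. Qed.

Lemma adjmx0 m n : adj (0 : 'M[K]_(m, n)) = 0.
Proof. by apply/matrixP => i j; rewrite !mxE rmorph0. Qed.

Lemma unitaryCK n (U : 'M[K]_n) : is_unitaryK U -> adj U *m U = 1%:M.
Proof. by move=> /mulmx1C. Qed.

Lemma unitary_adj n (U : 'M[K]_n) : is_unitaryK U -> is_unitaryK (adj U).
Proof. by move=> hU; rewrite /is_unitaryK adjmxK unitaryCK. Qed.

Definition nrm2 m n (A : 'M[K]_(m, n)) : R := \sum_i \sum_j normK2 (A i j).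

Lemma frobenius_sqr m n (A : 'M[K]_(m, n)) : frobenius A ^+ 2 = nrm2 A.
Proof.
rewrite /frobenius sqr_sqrtr; last by do 2!apply: sumr_ge0 => ? _; rewrite sqr_ge0.
by apply: eq_bigr => i _; apply: eq_bigr => j _; rewrite absK_sqr.
Qed.

Lemma nrm2_ge0 m n (A : 'M[K]_(m, n)) : 0 <= nrm2 A.
Proof. by do 2!apply: sumr_ge0 => ? _; rewrite normK2_ge0. Qed.

Lemma nrm2_eq0 m n (A : 'M[K]_(m, n)) : nrm2 A = 0 -> A = 0.
Proof.
move/eqP; rewrite psumr_eq0 => [/allP h|i _]; last first.
  by apply: sumr_ge0 => ? _; rewrite normK2_ge0.
apply/matrixP => i j; have := h i (mem_index_enum _); rewrite implyTb => /eqP h'.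
move/eqP: h'; rewrite psumr_eq0 => [/allP h'|? _]; last by rewrite normK2_ge0.
by have := h' j (mem_index_enum _); rewrite implyTb mxE => /eqP /normK2_eq0.
Qed.

Lemma nrm2_0 m n : nrm2 (0 : 'M[K]_(m, n)) = 0.
Proof.
rewrite /nrm2 big1 // => i _; rewrite big1 // => j _.
by rewrite mxE /normK2 !raddf0 expr0n addr0.
Qed.

Lemma mxtrace_mul_adj m n (A : 'M[K]_(m, n)) : \tr (A *m adj A) = (nrm2 A)%:K.
Proof.
rewrite /mxtrace /nrm2 rmorph_sum; apply: eq_bigr => i _.
rewrite mxE rmorph_sum; apply: eq_bigr => j _.
by rewrite adjmxE mul_conjK.
Qed.

Lemma nrm2E m n (A : 'M[K]_(m, n)) : nrm2 A = reK (\tr (A *m adj A)).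
Proof. by rewrite mxtrace_mul_adj reK_ofReal. Qed.

Lemma nrm2_adj m n (A : 'M[K]_(m, n)) : nrm2 (adj A) = nrm2 A.
Proof. by rewrite !nrm2E adjmxK mxtrace_mulC. Qed.

Lemma nrm2Z m n (a : K) (A : 'M[K]_(m, n)) : nrm2 (a *: A) = normK2 a * nrm2 A.
Proof.
rewrite /nrm2 mulr_sumr; apply: eq_bigr => i _; rewrite mulr_sumr.
by apply: eq_bigr => j _; rewrite mxE normK2M.
Qed.

Lemma nrm2_unitaryl m n (U : 'M[K]_m) (A : 'M[K]_(m, n)) :
  is_unitaryK U -> nrm2 (U *m A) = nrm2 A.
Proof.
move=> hU; rewrite -[LHS]nrm2_adj -[RHS]nrm2_adj !nrm2E !adjmxK adjmxM.
by rewrite mulmxA -(mulmxA (adj A)) unitaryCK // mulmx1.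
Qed.

Lemma nrm2_unitaryr m n (U : 'M[K]_n) (A : 'M[K]_(m, n)) :
  is_unitaryK U -> nrm2 (A *m U) = nrm2 A.
Proof.
by move=> hU; rewrite -nrm2_adj adjmxM nrm2_unitaryl ?nrm2_adj //; apply: unitary_adj.
Qed.

Lemma nrm2D_orth m n (A B : 'M[K]_(m, n)) :
  adj A *m B = 0 -> nrm2 (A + B) = nrm2 A + nrm2 B.
Proof.
move=> h; have h' : adj B *m A = 0 by rewrite -[LHS]adjmxK adjmxM adjmxK h adjmx0.
rewrite -nrm2_adj -(nrm2_adj A) -(nrm2_adj B) !nrm2E !adjmxK adjmxD mulmxDl !mulmxDr.
by rewrite h h' addr0 add0r raddfD raddfD.
Qed.

Lemma adj_mul_col n (w : 'cV[K]_n) : adj w *m w = ((nrm2 w)%:K)%:M.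
Proof.
apply/matrixP => i j; rewrite !ord1 [RHS]mxE eqxx mulr1n -nrm2_adj -mxtrace_mul_adj adjmxK.
by rewrite /mxtrace big_ord_recl big_ord0 addr0.
Qed.

Definition hproj n (Q : 'M[K]_n) : Prop := adj Q = Q /\ Q *m Q = Q.

Definition rtr n (Q : 'M[K]_n) : R := reK (\tr Q).

Lemma hproj1 n : hproj (1%:M : 'M[K]_n).
Proof. by split; rewrite ?adjmx1 ?mulmx1. Qed.

Lemma nrm2_hproj n (Q : 'M[K]_n) : hproj Q -> nrm2 Q = rtr Q.
Proof. by move=> [hQ QQ]; rewrite nrm2E hQ QQ. Qed.

(** For a Hermitian projector [Q], the projector onto the vectors of its range that are orthogonal
    to [v]. If [Q *m v = 0] the subtracted matrix vanishes and [Q] is unchanged. *)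
Definition shrink n (Q : 'M[K]_n) (v : 'cV[K]_n) : 'M[K]_n :=
  Q - (nrm2 (Q *m v))^-1%:K *: (Q *m v *m adj (Q *m v)).

Lemma shrink_mulr n (Q : 'M[K]_n) v : hproj Q ->
  shrink Q v = Q *m (1%:M - (nrm2 (Q *m v))^-1%:K *: (v *m adj (Q *m v))).
Proof. by move=> _; rewrite /shrink mulmxBr mulmx1 -scalemxAr !mulmxA. Qed.

Lemma shrink_hproj n (Q : 'M[K]_n) v : hproj Q -> hproj (shrink Q v).
Proof.
move=> [hQ QQ]; rewrite /shrink; set w := Q *m v; set a := nrm2 w.
have Qw : Q *m w = w by rewrite mulmxA QQ.
have wQ : adj w *m Q = adj w by rewrite -{1}hQ -adjmxM Qw.
split; first by rewrite adjmxB adjmxZ conjK_ofReal adjmxM adjmxK hQ.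
have ww : (w *m adj w) *m (w *m adj w) = a%:K *: (w *m adj w).
  by rewrite mulmxA -(mulmxA w) adj_mul_col mul_mx_scalar -scalemxAl.
rewrite mulmxBl !mulmxBr QQ -!scalemxAr -!scalemxAl ww mulmxA Qw -(mulmxA w) wQ.
have [->|a0] := eqVneq a 0; first by rewrite invr0 rmorph0 !scale0r !subr0.
by rewrite (scalerA a^-1%:K a%:K) -rmorphM mulVf // rmorph1 scale1r subrr subr0.
Qed.

Lemma shrink_tr n (Q : 'M[K]_n) v :
  rtr (shrink Q v) = rtr Q - (nrm2 (Q *m v) != 0)%:R.
Proof.
rewrite /rtr /shrink !raddfB /=; congr (_ - _).
rewrite mxtraceZ reK_ofRealM mxtrace_mul_adj reK_ofReal.
by have [->|a0] := eqVneq; rewrite ?mulr0 ?mulVf.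
Qed.

Lemma shrink_mul0 n (Q : 'M[K]_n) v p (u : 'M[K]_(n, p)) :
  hproj Q -> Q *m u = 0 -> shrink Q v *m u = 0.
Proof.
move=> [hQ _] Qu; have wu : adj (Q *m v) *m u = 0 by rewrite adjmxM hQ -mulmxA Qu mulmx0.
by rewrite /shrink mulmxBl Qu -scalemxAl -(mulmxA (Q *m v)) wu mulmx0 scaler0 subr0.
Qed.

Lemma shrink_self n (Q : 'M[K]_n) v : hproj Q -> shrink Q v *m v = 0.
Proof.
move=> [hQ QQ]; rewrite /shrink mulmxBl -scalemxAl -(mulmxA (Q *m v)).
have -> : adj (Q *m v) *m v = ((nrm2 (Q *m v))%:K)%:M.
  by rewrite -adj_mul_col mulmxA adjmxM hQ -(mulmxA _ Q Q) QQ.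
rewrite mul_mx_scalar scalerA -rmorphM.
have [h|a0] := eqVneq (nrm2 (Q *m v)) 0; last by rewrite mulVf // rmorph1 scale1r subrr.
by rewrite (nrm2_eq0 h) scaler0 subr0.
Qed.

Lemma shrink_equiv n (U Q : 'M[K]_n) v : is_unitaryK U ->
  shrink (U *m Q *m adj U) (U *m v) = U *m shrink Q v *m adj U.
Proof.
move=> hU; rewrite /shrink; have -> : U *m Q *m adj U *m (U *m v) = U *m (Q *m v).
  by rewrite -!mulmxA (mulmxA (adj U)) unitaryCK // mul1mx.
rewrite nrm2_unitaryl // mulmxBr mulmxBl -scalemxAr -scalemxAl; congr (_ - _ *: _).
by rewrite (adjmxM U) !mulmxA.
Qed.

Definition shrinks n (Q : 'M[K]_n) (vs : seq 'cV[K]_n) := foldl (@shrink n) Q vs.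

Lemma shrinks_hproj n (Q : 'M[K]_n) vs : hproj Q -> hproj (shrinks Q vs).
Proof. by elim: vs Q => //= v vs IH Q hQ; apply: IH; apply: shrink_hproj. Qed.

Lemma shrinks_mul0 n (Q : 'M[K]_n) vs p (u : 'M[K]_(n, p)) :
  hproj Q -> Q *m u = 0 -> shrinks Q vs *m u = 0.
Proof.
elim: vs Q => //= v vs IH Q hQ Qu.
by apply: IH; [apply: shrink_hproj|apply: shrink_mul0].
Qed.

Lemma shrinks_mem n (Q : 'M[K]_n) vs v :
  hproj Q -> v \in vs -> shrinks Q vs *m v = 0.
Proof.
elim: vs Q => //= w vs IH Q hQ; rewrite inE => /predU1P[->|vv].
  by apply: shrinks_mul0; [apply: shrink_hproj|apply: shrink_self].
by apply: IH => //; apply: shrink_hproj.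
Qed.

Lemma shrinks_equiv n (U Q : 'M[K]_n) vs : is_unitaryK U ->
  shrinks (U *m Q *m adj U) (map (mulmx U) vs) = U *m shrinks Q vs *m adj U.
Proof. by move=> hU; elim: vs Q => //= v vs IH Q; rewrite shrink_equiv. Qed.

(** A shrink along [v] adds to [1 - Q] a matrix whose columns are multiples of [Q v], and
    [A Q v = A v - A (1 - Q) v] lies in the range of [B]. *)
Lemma shrinks_range d n p (A : 'M[K]_(d, n)) (B : 'M[K]_(d, p)) (Q : 'M[K]_n) vs :
  hproj Q ->
  (exists Z, A *m (1%:M - Q) = B *m Z) ->
  (forall v, v \in vs -> exists z, A *m v = B *m z) ->
  exists Z, A *m (1%:M - shrinks Q vs) = B *m Z.
Proof.
elim: vs Q => //= v vs IH Q hQ [Z hZ] hv.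
apply: IH => [||u uvs]; [exact: shrink_hproj| |by apply: hv; rewrite inE uvs orbT].
have [z hz] := hv v (mem_head _ _).
rewrite /shrink; set a := _%:K; set w' := adj _.
exists (Z + a *: ((z - Z *m v) *m w')).
rewrite opprB addrA addrAC mulmxDr hZ mulmxDr; congr (_ + _).
rewrite -!scalemxAr !mulmxA; congr (_ *: (_ *m _)).
rewrite mulmxBr -hz mulmxA -hZ mulmxBr mulmx1 mulmxBl opprB addrC.
by rewrite subrK.
Qed.

(** In a rank factorization [Q = C D], idempotence forces [D C = 1], an identity matrix of size the
    rank; the trace is cyclic. *)
Lemma hproj_trace_rank n (Q : 'M[K]_n) : Q *m Q = Q -> \tr Q = (\rank Q)%:R.
Proof.
move=> QQ; have := col_base_full Q; have := row_base_free Q; have := mulmx_base Q.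
move: (col_base Q) (row_base Q) => C D e Dfree Cfull.
have Cfree : row_free C^T by rewrite /row_free mxrank_tr; apply: Cfull.
have DC : D *m C = 1%:M.
  have : C *m (D *m C) *m D = C *m 1%:M *m D by rewrite mulmx1 !mulmxA e -mulmxA e QQ.
  move/(row_free_inj Dfree) => h.
  by apply: trmx_inj; apply: (row_free_inj Cfree); rewrite /= -!trmx_mul h.
by rewrite -{1}e mxtrace_mulC DC mxtrace1.
Qed.

End Matrices.

(** * Sesquilinear forms and plane rotations *)

Section Forms.
Context (R : realType) (k : scalars) (n : nat).
Local Notation K := (fieldK R k).
Local Notation "x %:K" := (@ofRealK R k x) (at level 2, format "x %:K").
Local Notation adj := (@adjmx R k _ _).
Implicit Types (P M Q E U : 'M[K]_n) (u v : 'cV[K]_n).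

(* Indexed by [nat]; it is [0] when [n <= i]. *)
Definition ev (i : nat) : 'cV[K]_n := \col_(j < n) (j == i :> nat)%:R.

Definition form P u v : K := (adj u *m P *m v) 0 0.

Lemma adj_evE (i : nat) (j : 'I_n) : adj (ev i) 0 j = (j == i :> nat)%:R.
Proof. by rewrite adjmxE mxE rmorph_nat. Qed.

Lemma mulmx_evE m (A : 'M[K]_(m, n)) (i : 'I_n) : A *m ev i = col i A.
Proof.
apply/colP => a; rewrite !mxE (bigD1 i) //= big1 ?addr0 => [|b bi].
  by rewrite mxE eqxx mulr1.
by rewrite mxE -val_eqE /= in bi *; rewrite (negbTE bi) mulr0.
Qed.

Lemma ev_oob (i : nat) : (n <= i)%N -> ev i = 0.
Proof. by move=> ni; apply/colP => j; rewrite !mxE ltn_eqF // (leq_trans (ltn_ord j)). Qed.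

Lemma adj_ev_mulE m (A : 'M[K]_(n, m)) (i : 'I_n) : adj (ev i) *m A = row i A.
Proof.
apply/rowP => a; rewrite !mxE (bigD1 i) //= big1 ?addr0 => [|b bi].
  by rewrite adj_evE eqxx mul1r.
by rewrite adj_evE -val_eqE /= in bi *; rewrite (negbTE bi) mul0r.
Qed.

Lemma form_ev P (i j : 'I_n) : form P (ev i) (ev j) = P i j.
Proof. by rewrite /form adj_ev_mulE mulmx_evE !mxE. Qed.

Lemma form_lin P (a b c d : K) u u' v v' :
  form P (a *: u + b *: u') (c *: v + d *: v') =
  conjK a * c * form P u v + conjK a * d * form P u v' +
  conjK b * c * form P u' v + conjK b * d * form P u' v'.
Proof.
rewrite /form adjmxD !adjmxZ !mulmxDl !mulmxDr -!scalemxAl -!scalemxAr !scalerA.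
rewrite !mxE; ring.
Qed.

Lemma form_conj U P u v :
  form (U *m P *m adj U) u v = form P (adj U *m u) (adj U *m v).
Proof. by rewrite /form adjmxM adjmxK !mulmxA. Qed.

Lemma form_gram m (B : 'M[K]_(n, m)) v : form (B *m adj B) v v = (nrm2 (adj B *m v))%:K.
Proof.
by rewrite /form -mulmxA -(mulmxA B) mulmxA -(adjmxK B) -adjmxM adjmxK adj_mul_col mxE.
Qed.

Lemma form_hproj P v : hproj P -> form P v v = (nrm2 (P *m v))%:K.
Proof. by move=> [hP PP]; rewrite -{1}PP -{2}hP form_gram hP. Qed.

Lemma adj_ev_ev (i j : 'I_n) : adj (ev i) *m ev j = (i == j)%:R%:M.
Proof. by rewrite adj_ev_mulE; apply/matrixP => a b; rewrite !ord1 !mxE mulr1n. Qed.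

Lemma nrm2_ev (i : 'I_n) : nrm2 (ev i) = 1.
Proof.
have := adj_mul_col (ev i); rewrite adj_ev_ev eqxx => /matrixP/(_ 0 0).
by rewrite !mxE eqxx !mulr1n -(rmorph1 (@ofRealK R k)) => /(fmorph_inj (@ofRealK R k)).
Qed.

(** The 2 by 2 unitary [G] acts on the span of [ev j] and [ev i] through the isometry [F], and the
    identity acts on the orthogonal complement. *)
Lemma plane_rotation (i j : 'I_n) (c : R) (s : K) :
  i != j -> c ^+ 2 + normK2 s = 1 ->
  exists U, [/\ is_unitaryK U, U *m ev j = c%:K *: ev j + s *: ev i,
    U *m ev i = - conjK s *: ev j + c%:K *: ev i
    & forall m : nat, m != i -> m != j -> U *m ev m = ev m].
Proof.
move=> ij cs.
pose F : 'M[K]_(n, 1 + 1) := row_mx (ev j) (ev i).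
pose G : 'M[K]_(1 + 1) := block_mx (c%:K)%:M (- conjK s)%:M s%:M (c%:K)%:M.
have FF : adj F *m F = 1%:M.
  rewrite /adjmx tr_row_mx map_col_mx mul_col_row -!/(adjmx _) !adj_ev_ev !eqxx.
  by rewrite (negbTE ij) eq_sym (negbTE ij) (scalar_mx_block 1 1 1) !raddf0.
have GG : G *m adj G = 1%:M.
  rewrite /adjmx tr_block_mx map_block_mx mulmx_block !tr_scalar_mx !map_scalar_mx /=.
  rewrite -!scalar_mxM -!raddfD /=. rewrite rmorphN /= !conjK_ofReal conjKK !mulrNN !mul_conjK.
  rewrite [conjK s * s]mulrC mul_conjK -!rmorphM -!rmorphD /= -expr2 cs [_ + c ^+ 2]addrC cs.
  rewrite (scalar_mx_block 1 1 1) rmorph1; congr block_mx.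
    by rewrite mulNr [conjK s * _]mulrC addrN raddf0.
  by rewrite mulrN [s * _]mulrC addrN raddf0.
have GG' := unitaryCK GG.
pose U := 1%:M - F *m adj F + F *m G *m adj F.
have UF : U *m F = F *m G.
  by rewrite /U mulmxDl mulmxBl mul1mx -!mulmxA FF !mulmx1 subrr add0r.
have : U *m F = row_mx (c%:K *: ev j + s *: ev i) (- conjK s *: ev j + c%:K *: ev i).
  by rewrite UF mul_row_block !mul_mx_scalar.
rewrite mul_mx_row => /eq_row_mx[Uj Ui].
exists U; split=> // [|m mi mj]; last first.
  have Fm : adj F *m ev m = 0.
    have [nm|mn] := leqP n m; first by rewrite ev_oob ?mulmx0.
    rewrite /adjmx tr_row_mx map_col_mx mul_col_mx -!/(adjmx _).
    rewrite (adj_ev_ev j (Ordinal mn)) (adj_ev_ev i (Ordinal mn)) -!val_eqE /=.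
    by rewrite ![_ == m]eq_sym (negbTE mi) (negbTE mj) raddf0 col_mx0.
  by rewrite /U mulmxDl mulmxBl -!mulmxA Fm !mulmx0 subr0 addr0 mul1mx.
have adjU : adj U = 1%:M - F *m adj F + F *m adj G *m adj F.
  by rewrite /U adjmxD adjmxB adjmx1 !adjmxM !adjmxK mulmxA.
have FU : adj F *m adj U = adj G *m adj F by rewrite -!adjmxM UF.
rewrite /is_unitaryK {1}/U mulmxDl mulmxBl mul1mx -[F *m adj F *m _]mulmxA.
rewrite -(mulmxA (F *m G)) FU !mulmxA -(mulmxA F G) GG mulmx1 adjU.
by rewrite addrK subrK.
Qed.

End Forms.

(** * Oblique projectors along the range of a random matrix *)

Section States.
Context (R : realType) (k : scalars) (n l : nat).
Local Notation K := (fieldK R k).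
Local Notation "x %:K" := (@ofRealK R k x) (at level 2, format "x %:K").
Local Notation adj := (@adjmx R k _ _).
Local Notation ev := (@ev R k n).
Implicit Types (P Q E U : 'M[K]_n) (X : 'M[K]_(n, l)).

(** The orthogonal projector onto [K^r], seen as the span of the first [r] basis vectors. *)
Definition cutmx (r : nat) : 'M[K]_n := 1%:M - \sum_(r <= i < n) ev i *m adj (ev i).

(* The projector onto the vectors of [K^r] orthogonal to the range of [X]. *)
Definition coproj X (r : nat) : 'M[K]_n :=
  shrinks 1%:M ([seq col j X | j <- enum 'I_l] ++ [seq ev i | i <- rev (iota r (n - r))]).

(** For a Hermitian projector [P] with [P v] nonzero, [v* P v = |P v|^2], so that with [eps = 0] the
    step makes [v* E] vanish. A positive [eps] keeps the denominator away from zero. *)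
Definition oblique_step (eps : R) P E (v : 'cV[K]_n) : 'M[K]_n :=
  E - (nrm2 (P *m v) + eps)^-1%:K *: (P *m v *m (adj v *m E)).

(* First component: projector onto the compressed range of [X] intersected with
   the orthogonal complement of the first [q] basis vectors.  Second component:
   for [eps = 0], the oblique projector along the compressed range of [X] onto a
   space orthogonal to these basis vectors. *)
Fixpoint state (eps : R) X (r q : nat) : 'M[K]_n * 'M[K]_n :=
  if q is q'.+1 then
    let: (P, E) := state eps X r q' in
    (shrink P (ev q'), oblique_step eps P E (ev q'))
  else (cutmx r - coproj X r, coproj X r).

Definition stP eps X r q := (state eps X r q).1.
Definition stE eps X r q := (state eps X r q).2.

Lemma stP0 eps X r : stP eps X r 0 = cutmx r - coproj X r. Proof. by []. Qed.

Lemma stE0 eps X r : stE eps X r 0 = coproj X r. Proof. by []. Qed.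

Lemma stPS eps X r q : stP eps X r q.+1 = shrink (stP eps X r q) (ev q).
Proof. by rewrite /stP /=; case: state. Qed.

Lemma stES eps X r q :
  stE eps X r q.+1 = oblique_step eps (stP eps X r q) (stE eps X r q) (ev q).
Proof. by rewrite /stP /stE /=; case: state. Qed.

Lemma coproj_hproj X r : hproj (coproj X r).
Proof. by apply: shrinks_hproj; apply: hproj1. Qed.

(** The basis vectors enter [coproj] in decreasing order, so [ev r] is the last one to be
    removed. *)
Lemma coprojS X r : (r < n)%N -> coproj X r = shrink (coproj X r.+1) (ev r).
Proof.
move=> rn; rewrite /coproj -(subnSK rn).
by rewrite [iota r _]/= rev_cons map_rcons -rcons_cat /shrinks foldl_rcons.
Qed.

Lemma coproj_ev X (r i : nat) : (r <= i)%N -> coproj X r *m ev i = 0.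
Proof.
move=> ri; have [ni|lin] := leqP n i; first by rewrite ev_oob ?mulmx0.
apply: shrinks_mem; first exact: hproj1.
rewrite mem_cat; apply/orP; right; apply: map_f; rewrite mem_rev mem_iota ri subnKC //.
by rewrite (leq_trans ri) // ltnW.
Qed.

Lemma coproj_mul X : coproj X n *m X = 0.
Proof.
apply/matrixP => i j; rewrite [RHS]mxE; transitivity ((coproj X n *m col j X) i 0).
  by rewrite !mxE; apply: eq_bigr => a _; rewrite mxE.
rewrite shrinks_mem ?mxE //; first exact: hproj1.
by rewrite mem_cat; apply/orP; left; apply: (map_f (fun j => col j X)); rewrite mem_enum.
Qed.

Lemma coproj_rtr X : (l <= n)%N -> \rank X = l -> rtr (coproj X n) <= n%:R - l%:R.
Proof.
move=> ln rX; have [_ QQ] := coproj_hproj X n.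
have := mulmx0_rank_max (coproj_mul X); rewrite rX => h.
rewrite /rtr hproj_trace_rank // -natrB // -(rmorph_nat (@ofRealK R k)) reK_ofReal ler_nat.
by rewrite leq_subRL // addnC.
Qed.

Lemma coproj_range d (A : 'M[K]_(d, n)) X r :
  (forall i, (r <= i)%N -> A *m ev i = 0) ->
  exists Z, A *m (1%:M - coproj X r) = (A *m X) *m Z.
Proof.
move=> A0; apply: shrinks_range; first exact: hproj1.
  by exists 0; rewrite subrr !mulmx0.
move=> v; rewrite mem_cat => /orP[/mapP[i _ ->]|/mapP[i + ->]].
  by exists (delta_mx i 0); rewrite -mulmxA -colE.
by rewrite mem_rev mem_iota => /andP[ri _]; exists 0; rewrite A0 // mulmx0.
Qed.

Lemma coproj_equiv U X r : is_unitaryK U -> (forall i, (r <= i)%N -> U *m ev i = ev i) ->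
  coproj (U *m X) r = U *m coproj X r *m adj U.
Proof.
move=> hU fU; rewrite /coproj -shrinks_equiv // mulmx1 hU map_cat -!map_comp; congr shrinks.
congr (_ ++ _); first by apply: eq_map => j /=; rewrite !colE mulmxA.
by apply/eq_in_map => i; rewrite mem_rev mem_iota => /andP[ri _] /=; rewrite fU.
Qed.

Lemma cutmx_ev_big (r i : nat) : (r <= i)%N -> cutmx r *m ev i = 0.
Proof.
move=> ri; have [ni|lin] := leqP n i; first by rewrite ev_oob ?mulmx0.
rewrite /cutmx mulmxBl mul1mx mulmx_suml (bigD1_seq i) ?iota_uniq //=; last first.
  by rewrite mem_index_iota ri.
rewrite big_nat_cond big1 => [|j /andP[/andP[rj jn] ji]]; rewrite -mulmxA.
  by rewrite (adj_ev_ev R k (Ordinal lin) (Ordinal lin)) eqxx mulmx1 addr0 subrr.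
rewrite (adj_ev_ev R k (Ordinal jn) (Ordinal lin)) -val_eqE /=.
by rewrite (negbTE ji) raddf0 mulmx0.
Qed.

Lemma adj_cutmx r : adj (cutmx r) = cutmx r.
Proof.
rewrite /cutmx adjmxB adjmx1; congr (_ - _); rewrite /adjmx raddf_sum /= map_mx_sum.
apply: eq_bigr => i _; rewrite -[RHS](adjmxK (ev i *m _)) [in RHS]adjmxM adjmxK.
by [].
Qed.

Lemma cutmx_hproj r : hproj (cutmx r).
Proof.
split; first exact: adj_cutmx.
rewrite {2}/cutmx mulmxBr mulmx1 mulmx_sumr big_nat big1 ?subr0 // => i /andP[ri _].
by rewrite mulmxA cutmx_ev_big // mul0mx.
Qed.

Lemma cutmx_mul m (A : 'M[K]_(n, m)) r :
  (forall i, (r <= i)%N -> adj (ev i) *m A = 0) -> cutmx r *m A = A.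
Proof.
move=> A0; rewrite /cutmx mulmxBl mul1mx mulmx_suml big_nat big1 ?subr0 // => i /andP[ri _].
by rewrite -mulmxA A0 // mulmx0.
Qed.

Lemma cutmx_rtr r : (r <= n)%N -> rtr (cutmx r) = r%:R.
Proof.
move=> rn; rewrite /rtr /cutmx raddfB /= (raddf_sum (@mxtrace _ n)) mxtrace1.
have -> : \sum_(r <= i < n) \tr (ev i *m adj (ev i)) = \sum_(r <= i < n) (1 : K).
  apply: eq_big_nat => i /andP[_ lin].
  rewrite mxtrace_mulC (adj_ev_ev R k (Ordinal lin) (Ordinal lin)) eqxx.
  by rewrite mxtrace_scalar.
rewrite sumr_const_nat -natrB ?leq_subr // subKn //.
by rewrite -(rmorph_nat (@ofRealK R k)) reK_ofReal.
Qed.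

Lemma cutmx_equiv U r : is_unitaryK U -> (forall i, (r <= i)%N -> U *m ev i = ev i) ->
  U *m cutmx r *m adj U = cutmx r.
Proof.
move=> hU fU; rewrite /cutmx mulmxBr mulmx1 mulmxBl hU; congr (_ - _).
rewrite mulmx_sumr mulmx_suml [LHS]big_nat [RHS]big_nat; apply: eq_bigr => i /andP[ri _].
by rewrite mulmxA -mulmxA -adjmxM fU.
Qed.

Lemma cutmx_range d (A : 'M[K]_(d, n)) r :
  (forall i, (r <= i)%N -> A *m ev i = 0) -> A *m cutmx r = A.
Proof.
move=> A0; rewrite /cutmx mulmxBr mulmx1 mulmx_sumr big_nat big1 ?subr0 // => i /andP[ri _].
by rewrite mulmxA A0 // mul0mx.
Qed.

Lemma adj_ev_coproj X (r i : nat) : (r <= i)%N -> adj (ev i) *m coproj X r = 0.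
Proof.
move=> ri; have [hQ _] := coproj_hproj X r.
by rewrite -hQ -adjmxM coproj_ev // adjmx0.
Qed.

Lemma cutmx_coproj X r : cutmx r *m coproj X r = coproj X r.
Proof. by apply: cutmx_mul => i; apply: adj_ev_coproj. Qed.

Lemma hprojB P Q : hproj P -> hproj Q -> P *m Q = Q -> hproj (P - Q) /\ (P - Q) *m Q = 0.
Proof.
move=> [hP PP] [hQ QQ] PQ; have QP : Q *m P = Q by rewrite -{1}hQ -hP -adjmxM PQ.
split; last by rewrite mulmxBl PQ QQ subrr.
by split; rewrite ?adjmxB ?hP ?hQ // mulmxBl !mulmxBr PQ QP QQ PP subrr subr0.
Qed.

Lemma stP_hproj eps X r q : hproj (stP eps X r q).
Proof.
elim: q => [|q IH]; last by rewrite stPS; apply: shrink_hproj.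
by have [] := hprojB (cutmx_hproj r) (coproj_hproj X r) (cutmx_coproj X r).
Qed.

Lemma stP_ev eps X (r q i : nat) : (i < q)%N || (r <= i)%N -> stP eps X r q *m ev i = 0.
Proof.
elim: q => [|q IH] /=.
  by move=> ri; rewrite stP0 mulmxBl cutmx_ev_big // coproj_ev // subrr.
rewrite stPS ltnS leq_eqVlt -orbA => /predU1P[->|h].
  exact/shrink_self/stP_hproj.
by apply: shrink_mul0; [apply: stP_hproj|apply: IH].
Qed.

Lemma rtrB P Q : rtr (P - Q) = rtr P - rtr Q.
Proof. by rewrite /rtr !raddfB. Qed.

(** The initial trace is [r] minus that of [coproj X r], and each shrink costs at most one. *)
Lemma stP_rtr eps X r q : (r <= n)%N ->
  r%:R - rtr (coproj X r) - q%:R <= rtr (stP eps X r q).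
Proof.
move=> rn; elim: q => [|q IH].
  by rewrite subr0 stP0 rtrB cutmx_rtr.
rewrite stPS shrink_tr -natr1 opprD addrA lerD //.
by rewrite lerN2; case: eqP; rewrite ?ler01.
Qed.

Lemma adj_ev_form P (i : nat) : hproj P ->
  adj (ev i) *m (P *m ev i) = ((nrm2 (P *m ev i))%:K)%:M.
Proof.
move=> hP; apply/matrixP => a b; rewrite !ord1 [RHS]mxE eqxx mulr1n -form_hproj //.
by rewrite /form mulmxA.
Qed.

(** A step changes [E] along [P v] only, and the shrunk projector annihilates both [E] and [P v].
    This invariant gives the Pythagorean identity of [stE_nrm2] and the relation [P M = 0] used in
    the integration by parts. *)
Lemma stPE eps X r q : stP eps X r q *m stE eps X r q = 0.
Proof.
elim: q => [|q IH].
  by have [] := hprojB (cutmx_hproj r) (coproj_hproj X r) (cutmx_coproj X r).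
have hP := stP_hproj eps X r q; have [aP PP] := hP.
rewrite stPS stES; set P := stP eps X r q in hP aP PP IH *; set E := stE _ _ _ _ in IH *.
have hE : shrink P (ev q) *m E = 0 by apply: shrink_mul0.
have hu : shrink P (ev q) *m (P *m ev q) = 0.
  have uP : adj (P *m ev q) *m P = adj (P *m ev q) by rewrite -{2}aP -adjmxM mulmxA PP.
  have SP : shrink P (ev q) *m P = shrink P (ev q).
    by rewrite /shrink mulmxBl PP -scalemxAl -(mulmxA (P *m ev q)) uP.
  by rewrite mulmxA SP shrink_self.
by rewrite /oblique_step mulmxBr hE -scalemxAr (mulmxA (shrink P (ev q))) hu mul0mx scaler0 subrr.
Qed.

Lemma nrm2_col_row (w : 'cV[K]_n) m (b : 'M[K]_(1, m)) :
  nrm2 (w *m b) = nrm2 w * nrm2 b.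
Proof.
rewrite nrm2E adjmxM mulmxA mxtrace_mulC !mulmxA adj_mul_col mul_scalar_mx -scalemxAl.
by rewrite mxtraceZ reK_ofRealM -nrm2E.
Qed.

(** The columns of the correction lie in the range of [P], hence are orthogonal to those of [E] by
    [stPE]; the correction is a column times a row, so its norm factors. *)
Lemma stE_nrm2 eps X r q (P := stP eps X r q) (E := stE eps X r q) :
  nrm2 (stE eps X r q.+1) =
  nrm2 E + nrm2 (P *m ev q) * nrm2 (adj (ev q) *m E) / (nrm2 (P *m ev q) + eps) ^+ 2.
Proof.
have [aP PP] := stP_hproj eps X r q; rewrite -/P in aP PP.
have EP : adj E *m P = 0 by rewrite -aP -adjmxM stPE adjmx0.
rewrite stES -/P -/E /oblique_step nrm2D_orth; last first.
  rewrite mulmxN -scalemxAr; apply/eqP; rewrite oppr_eq0; apply/eqP.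
  by rewrite !mulmxA EP !mul0mx scaler0.
congr (_ + _); rewrite -scalerN nrm2Z normK2_ofReal mulrC exprVn; congr (_ * _).
rewrite -scaleN1r nrm2Z -(rmorph1 (@ofRealK R k)) -rmorphN normK2_ofReal sqrrN expr1n mul1r.
exact: nrm2_col_row.
Qed.

Lemma stE_row_keep eps X (r q i : nat) : (i < q)%N || (r <= i)%N ->
  adj (ev i) *m stE eps X r q.+1 = adj (ev i) *m stE eps X r q.
Proof.
move=> iq; have [aP _] := stP_hproj eps X r q.
have eP : adj (ev i) *m stP eps X r q = 0 by rewrite -aP -adjmxM stP_ev // adjmx0.
by rewrite stES /oblique_step mulmxBr -scalemxAr !mulmxA eP !mul0mx scaler0 subr0.
Qed.

(** The row loses the fraction [a / (a + eps)] of itself, because [P] has diagonal entry [a] there;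
    the remainder is the price of the regularization. *)
Lemma stE_row_new eps X (r q : nat) (a := nrm2 (stP eps X r q *m ev q)) :
  0 < eps ->
  adj (ev q) *m stE eps X r q.+1 = (eps / (a + eps))%:K *: (adj (ev q) *m stE eps X r q).
Proof.
move=> eps0; have hP := stP_hproj eps X r q.
have a0 : a + eps != 0 by rewrite gt_eqF // ltr_wpDl // nrm2_ge0.
rewrite stES /oblique_step mulmxBr -scalemxAr (mulmxA (adj _)) adj_ev_form // -/a.
rewrite mul_scalar_mx scalerA -rmorphM -[X in X - _]scale1r -(rmorph1 (@ofRealK R k)).
by rewrite -scalerBl -rmorphB; congr (_%:K *: _); field.
Qed.

Lemma stP_range eps d (A : 'M[K]_(d, n)) X r q :
  (forall i, (r <= i)%N -> A *m ev i = 0) ->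
  exists Z, A *m stP eps X r q = (A *m X) *m Z.
Proof.
move=> A0; elim: q => [|q [Y hY]].
  have [Z hZ] := coproj_range X A0.
  by exists Z; rewrite -hZ stP0 mulmxBr cutmx_range // mulmxBr mulmx1.
rewrite stPS shrink_mulr; last exact: stP_hproj.
by rewrite mulmxA hY -mulmxA; eexists.
Qed.

(** This makes [E] an admissible error matrix: every correction starts with [P v], and [A P] factors
    through [A X] by [stP_range]. *)
Lemma stE_range eps d (A : 'M[K]_(d, n)) X r q :
  (forall i, (r <= i)%N -> A *m ev i = 0) ->
  exists Z, A *m (1%:M - stE eps X r q) = (A *m X) *m Z.
Proof.
move=> A0; elim: q => [|q [Z hZ]]; first exact: coproj_range.
have [Y hY] := stP_range eps X q A0; move: (A *m X) Z Y hZ hY => B Z Y hZ hY.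
rewrite stES /oblique_step opprB addrA addrAC mulmxDr hZ -scalemxAr !mulmxA hY -!mulmxA.
by rewrite scalemxAr -mulmxDr; eexists.
Qed.

Lemma oblique_step_equiv eps U P E v : is_unitaryK U ->
  oblique_step eps (U *m P *m adj U) (U *m E *m adj U) (U *m v) =
  U *m oblique_step eps P E v *m adj U.
Proof.
move=> hU; rewrite /oblique_step.
have -> : U *m P *m adj U *m (U *m v) = U *m (P *m v).
  by rewrite -!mulmxA (mulmxA (adj U)) unitaryCK // mul1mx.
have -> : adj (U *m v) *m (U *m E *m adj U) = adj v *m E *m adj U.
  by rewrite adjmxM -!mulmxA (mulmxA (adj U)) unitaryCK // mul1mx.
rewrite nrm2_unitaryl // mulmxBr mulmxBl -scalemxAr -scalemxAl.
by congr (_ - _ *: _); rewrite !mulmxA.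
Qed.

(** The construction refers to [X] and to the basis vectors of index below [q] or at least [r], and
    otherwise only to the Hermitian structure; a unitary fixing these vectors therefore acts by
    conjugation. *)
Lemma state_equiv eps U X r q : is_unitaryK U ->
  (forall i, (i < q)%N || (r <= i)%N -> U *m ev i = ev i) ->
  stP eps (U *m X) r q = U *m stP eps X r q *m adj U /\
  stE eps (U *m X) r q = U *m stE eps X r q *m adj U.
Proof.
move=> hU; elim: q => [|q IH] fU.
  have eQ := coproj_equiv X hU fU; have eC := cutmx_equiv hU fU.
  by rewrite !stE0 !stP0 eQ (mulmxBr U) (mulmxBl _ _ (adj U)) eC.
have [|hP hE] := IH.
  by move=> i /orP[iq|ri]; apply: fU; rewrite ?ri ?orbT // ltnS ltnW.
have fq : U *m ev q = ev q by apply: fU; rewrite ltnSn.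
rewrite !stPS !stES hP hE.
by split; rewrite -{1}fq; [apply: shrink_equiv|apply: oblique_step_equiv].
Qed.

End States.

(** * Measurability and expectation *)

Section Measurability.
Local Open Scope classical_set_scope.
Context (R : realType) (k : scalars) (n l : nat).
Local Notation K := (fieldK R k).
Local Notation "x %:K" := (@ofRealK R k x) (at level 2, format "x %:K").
Local Notation adj := (@adjmx R k _ _).
Local Notation MX := (borelmx R k n l).

Lemma ltK_ofReal (z : K) (e : R) :
  `|z| < e%:K -> `|reK z| < e /\ `|imK z| < e.
Proof.
rewrite /reK /imK; case: k z => /= [x xe|[a b]].
  by rewrite normr0; split=> //; apply: le_lt_trans xe.
rewrite ltcE /= => /andP[_ h]; split; apply: le_lt_trans h;
  by rewrite -sqrtr_sqr ler_sqrt ?lerDl ?lerDr ?addr_ge0 ?sqr_ge0.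
Qed.

Lemma ofRealK_gt0 (e : R) : 0 < e -> (0 : K) < e%:K.
Proof. by case: k => //=; rewrite ltcR. Qed.

Lemma open_reK_gt (a : R) : open [set z : K | a < reK z].
Proof.
rewrite openE => z /= az; apply/nbhs_ballP.
exists (reK z - a)%:K => /=; first by rewrite ofRealK_gt0 // subr_gt0.
move=> y; rewrite -ball_normE /= => /ltK_ofReal[+ _].
by rewrite raddfB /= ltr_norml => /andP[_]; rewrite ltrD2l ltrN2.
Qed.

Lemma open_imK_gt (a : R) : open [set z : K | a < imK z].
Proof.
rewrite openE => z /= az; apply/nbhs_ballP.
exists (imK z - a)%:K => /=; first by rewrite ofRealK_gt0 // subr_gt0.
move=> y; rewrite -ball_normE /= => /ltK_ofReal[_].
by rewrite raddfB /= ltr_norml => /andP[_]; rewrite ltrD2l ltrN2.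
Qed.

Lemma measurable_open_gt (f : MX -> R) :
  (forall a : R, open [set X : 'M[K]_(n, l) | a < f X]) -> measurable_fun setT f.
Proof.
move=> fo; apply: (measurability _ (RGenOInfty.measurableE R)) => _ [_ [a ->] <-].
rewrite setTI; apply: sub_sigma_algebra.
have -> : f @^-1` `]a, +oo[ = [set X : 'M[K]_(n, l) | a < f X].
  by apply/seteqP; split=> X /=; rewrite in_itv /= andbT.
exact: fo.
Qed.

(** Real and imaginary parts are treated separately, so that both fields reduce to real-valued
    functions. *)
Definition measK (f : MX -> K) : Prop :=
  measurable_fun setT (fun X => reK (f X)) /\ measurable_fun setT (fun X => imK (f X)).

Definition measmx m p (F : MX -> 'M[K]_(m, p)) : Prop :=
  forall i j, measK (fun X => F X i j).

Lemma measK_cst (z : K) : measK (fun=> z).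
Proof. by split; apply: measurable_cst. Qed.

Lemma measK_D f g : measK f -> measK g -> measK (fun X => f X + g X).
Proof.
move=> [f1 f2] [g1 g2]; split.
  by under eq_fun do rewrite raddfD /=; apply: measurable_funD.
by under eq_fun do rewrite raddfD /=; apply: measurable_funD.
Qed.

Lemma measK_N f : measK f -> measK (fun X => - f X).
Proof.
move=> [f1 f2]; split.
  by under eq_fun do rewrite raddfN /=; apply: measurable_funN.
by under eq_fun do rewrite raddfN /=; apply: measurable_funN.
Qed.

Lemma measK_M f g : measK f -> measK g -> measK (fun X => f X * g X).
Proof.
move=> [f1 f2] [g1 g2]; split.
  by under eq_fun do rewrite reKM; apply: measurable_funB; apply: measurable_funM.
by under eq_fun do rewrite imKM; apply: measurable_funD; apply: measurable_funM.
Qed.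

Lemma measK_conj f : measK f -> measK (fun X => conjK (f X)).
Proof.
move=> [f1 f2]; split; first by under eq_fun do rewrite reK_conj.
by under eq_fun do rewrite imK_conj; apply: measurable_funN.
Qed.

Lemma measK_ofReal (f : MX -> R) : measurable_fun setT f -> measK (fun X => (f X)%:K).
Proof.
move=> mf; split; first by under eq_fun do rewrite reK_ofReal.
by under eq_fun do rewrite imK_ofReal; apply: measurable_cst.
Qed.

Lemma measK_sum I (s : seq I) (f : I -> MX -> K) :
  (forall i, measK (f i)) -> measK (fun X => \sum_(i <- s) f i X).
Proof.
move=> mf; elim: s => [|i s IH].
  by under eq_fun do rewrite big_nil; apply: measK_cst.
by under eq_fun do rewrite big_cons; apply: measK_D.
Qed.

Lemma measmx_id : measmx (fun X => X).
Proof.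
move=> i j; have /continuousP cij := @coord_continuous K n l i j.
split; apply: measurable_open_gt => a; first exact: (cij _ (@open_reK_gt a)).
exact: (cij _ (@open_imK_gt a)).
Qed.

Lemma measmx_cst m p (A : 'M[K]_(m, p)) : measmx (fun=> A).
Proof. by move=> i j; apply: measK_cst. Qed.

Lemma measmx_B m p (F G : MX -> 'M[K]_(m, p)) :
  measmx F -> measmx G -> measmx (fun X => F X - G X).
Proof.
by move=> mF mG i j; under eq_fun do rewrite !mxE; apply: measK_D => //; apply: measK_N.
Qed.

Lemma measmx_M m p q (F : MX -> 'M[K]_(m, p)) (G : MX -> 'M[K]_(p, q)) :
  measmx F -> measmx G -> measmx (fun X => F X *m G X).
Proof.
move=> mF mG i j; under eq_fun do rewrite mxE.
by apply: measK_sum => a; apply: measK_M.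
Qed.

Lemma measmx_adj m p (F : MX -> 'M[K]_(m, p)) : measmx F -> measmx (fun X => adj (F X)).
Proof. by move=> mF i j; under eq_fun do rewrite adjmxE; apply: measK_conj. Qed.

Lemma measmx_Z m p (f : MX -> R) (F : MX -> 'M[K]_(m, p)) :
  measurable_fun setT f -> measmx F -> measmx (fun X => (f X)%:K *: F X).
Proof.
move=> mf mF i j; under eq_fun do rewrite mxE.
by apply: measK_M => //; apply: measK_ofReal.
Qed.

Lemma measurable_nrm2 m p (F : MX -> 'M[K]_(m, p)) :
  measmx F -> measurable_fun setT (fun X => nrm2 (F X)).
Proof.
move=> mF; apply: measurable_sum => i; apply: measurable_sum => j.
by have [m1 m2] := mF i j; apply: measurable_funD; apply: measurable_funX.
Qed.

Lemma measurable_inv_ge0 (f : MX -> R) :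
  (forall X, 0 <= f X) -> measurable_fun setT f -> measurable_fun setT (fun X => (f X)^-1).
Proof.
(* On nonnegative reals the inverse is the power [-1], even at [0], where both take the value
   [0]. *)
move=> f0 mf; under eq_fun do rewrite -powR_inv1 //.
exact: (measurableT_comp (@measurable_powR R (-1))).
Qed.

Lemma measmx_shrink p (F : MX -> 'M[K]_p) (v : MX -> 'cV[K]_p) :
  measmx F -> measmx v -> measmx (fun X => shrink (F X) (v X)).
Proof.
move=> mF mv; have mFv := measmx_M mF mv; apply: measmx_B => //; apply: measmx_Z.
  by apply: measurable_inv_ge0; [move=> X; apply: nrm2_ge0|apply: measurable_nrm2].
by apply: measmx_M => //; apply: measmx_adj.
Qed.

Lemma measmx_shrinks p I (s : seq I) (F : MX -> 'M[K]_p) (v : I -> MX -> 'cV[K]_p) :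
  measmx F -> (forall i, measmx (v i)) ->
  measmx (fun X => shrinks (F X) [seq v i X | i <- s]).
Proof.
move=> + mv; elim: s F => //= i s IH F mF.
by apply: (IH (fun X => shrink (F X) (v i X))); apply: measmx_shrink.
Qed.

Lemma measmx_coproj r : measmx (fun X : MX => coproj X r).
Proof.
(* The two batches of vectors are separated: the columns of [X] vary with [X], the basis vectors are
   constant. *)
have -> : (fun X : MX => coproj X r) = (fun X : MX =>
    shrinks (shrinks 1%:M [seq X *m delta_mx j 0 | j <- enum 'I_l])
      [seq ev R k n i | i <- rev (iota r (n - r))]).
  apply/funext => X; rewrite /coproj /shrinks foldl_cat; congr (foldl _ (foldl _ _ _) _).
  by apply: eq_map => j; rewrite colE.
apply: (@measmx_shrinks _ _ _ _ (fun i _ => ev R k n i)) => [|i]; last exact: measmx_cst.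
apply: (@measmx_shrinks _ _ _ (fun _ => 1%:M)
  (fun j (X : MX) => (X : 'M[K]_(n, l)) *m delta_mx j 0)) => [|j].
  exact: measmx_cst.
by apply: (@measmx_M _ _ _ (fun X => X)); [apply: measmx_id|apply: measmx_cst].
Qed.

Lemma measmx_state eps r q : 0 <= eps ->
  measmx (fun X : MX => stP eps X r q) /\ measmx (fun X : MX => stE eps X r q).
Proof.
move=> eps0; elim: q => [|q [mP mE]].
  split; last exact: measmx_coproj.
  by apply: measmx_B; [apply: measmx_cst|apply: measmx_coproj].
split; [under [X in measmx X]eq_fun do rewrite stPS|under [X in measmx X]eq_fun do rewrite stES].
  by apply: measmx_shrink => //; apply: measmx_cst.
have mPe := measmx_M mP (measmx_cst (ev R k n q)).
apply: measmx_B => //; apply: measmx_Z; last first.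
  by apply: measmx_M => //; apply: measmx_M => //; apply: measmx_cst.
apply: measurable_inv_ge0; first by move=> X; rewrite addr_ge0 // nrm2_ge0.
by apply: measurable_funD; [apply: measurable_nrm2|apply: measurable_cst].
Qed.

Lemma continuous_mulmx (U : 'M[K]_n) : continuous (fun X : 'M[K]_(n, l) => U *m X).
Proof.
have cont i j (s : seq 'I_n) :
    continuous (fun Y : 'M[K]_(n, l) => \sum_(a <- s) U i a * Y a j).
  elim: s => [|a s IH].
    by under eq_fun do rewrite big_nil; move=> X; apply: cst_continuous.
  under eq_fun do rewrite big_cons; move=> X.
  apply: (@continuousD _ _ _ (fun Y : 'M[K]_(n, l) => U i a * Y a j)); last exact: IH.
  apply: (@continuousM _ _ (fun=> U i a)); first exact: cst_continuous.
  exact: coord_continuous.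
move=> X B /nbhs_ballP[e /= e0 eB]; have FX : Filter (nbhs X) by apply: nbhs_filter.
have entry i j : nbhs X [set Y | ball ((U *m X) i j) e ((U *m Y) i j)].
  have h := cont i j (index_enum 'I_n) X _ (nbhsx_ballx _ _ e0).
  by apply: (@filterS _ _ FX _ _ _ h) => Y /=; rewrite !mxE.
have h : nbhs X [set Y | forall i j, ball ((U *m X) i j) e ((U *m Y) i j)].
  by apply: (@filter_forall _ _ _ _ FX) => i; apply: (@filter_forall _ _ _ _ FX) => j; apply: entry.
by apply: (@filterS _ _ FX _ _ _ h) => Y hY; apply: eB; split.
Qed.

Lemma measurable_mulmx (U : 'M[K]_n) :
  measurable_fun setT (fun X : MX => U *m X : MX).
Proof.
apply: (@measurability _ _ MX MX setT _ (@open 'M[K]_(n, l)) erefl) => _ [B oB <-].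
rewrite setTI; apply: sub_sigma_algebra.
have /continuousP : continuous (fun X : 'M[K]_(n, l) => U *m X); last by apply.
exact: continuous_mulmx.
Qed.

End Measurability.

(** * Expectation of bounded measurable functions of the random matrix *)

Section Expectation.
Local Open Scope classical_set_scope.
Context (R : realType) (k : scalars) (n l : nat).
Local Notation K := (fieldK R k).
Local Notation MX := (borelmx R k n l).
Context (disp : measure_display) (T : measurableType disp) (P : probability T R).
Variable Omega : {RV P >-> MX}.
Hypothesis invariant : forall U : 'M[K]_n, is_unitaryK U ->
  eq_in_distribution P Omega (fun w => U *m (Omega w : 'M[K]_(n, l)) : MX).

(** This class is closed under the operations below and consists of functions integrable for every
    probability. *)
Definition bmeas (f : MX -> R) : Prop :=
  measurable_fun setT f /\ exists C, forall X, `|f X| <= C.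

Lemma bmeas_cst (c : R) : bmeas (fun=> c).
Proof. by split; [apply: measurable_cst|exists `|c|]. Qed.

Lemma bmeasD f g : bmeas f -> bmeas g -> bmeas (fun X => f X + g X).
Proof.
move=> [mf [C fC]] [mg [D gD]]; split; first exact: measurable_funD.
by exists (C + D) => X; rewrite (le_trans (ler_normD _ _)) // lerD.
Qed.

Lemma bmeasM f g : bmeas f -> bmeas g -> bmeas (fun X => f X * g X).
Proof.
move=> [mf [C fC]] [mg [D gD]]; split; first exact: measurable_funM.
by exists (C * D) => X; rewrite normrM ler_pM.
Qed.

Lemma bmeasZ c f : bmeas f -> bmeas (fun X => c * f X).
Proof. by move=> mf; apply: bmeasM => //; apply: bmeas_cst. Qed.

Lemma bmeasN f : bmeas f -> bmeas (fun X => - f X).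
Proof.
by move=> mf; under eq_fun do rewrite -mulN1r; apply: bmeasZ.
Qed.

Lemma bmeasB f g : bmeas f -> bmeas g -> bmeas (fun X => f X - g X).
Proof. by move=> mf mg; apply: bmeasD => //; apply: bmeasN. Qed.

Lemma bmeas_sum (I : eqType) (s : seq I) (f : I -> MX -> R) :
  (forall i, i \in s -> bmeas (f i)) -> bmeas (fun X => \sum_(i <- s) f i X).
Proof.
elim: s => [|i s IH] mf.
  by under eq_fun do rewrite big_nil; apply: bmeas_cst.
under eq_fun do rewrite big_cons; apply: bmeasD; first by apply: mf; rewrite mem_head.
by apply: IH => a sa; apply: mf; rewrite inE sa orbT.
Qed.

Lemma bmeas_inv (e : R) f : 0 < e -> (forall X, e <= f X) ->
  measurable_fun setT f -> bmeas (fun X => (f X)^-1).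
Proof.
move=> e0 ef mf; have f0 X : 0 < f X by apply: lt_le_trans (ef X).
split; first by apply: measurable_inv_ge0 => // X; rewrite ltW.
exists e^-1 => X; have fX : 0 <= (f X)^-1 by rewrite invr_ge0 ltW.
by rewrite ger0_norm // lef_pV2 ?posrE.
Qed.

Definition EE (f : MX -> R) : R := (\int[P]_w f (Omega w))%R.

Lemma measurable_comp_Omega (f : MX -> R) :
  measurable_fun setT f -> measurable_fun setT (fun w => f (Omega w)).
Proof. by move=> mf; apply: (measurableT_comp mf). Qed.

Lemma bmeas_integrable f : bmeas f -> P.-integrable setT (EFin \o (fun w => f (Omega w))).
Proof.
move=> [mf [C fC]]; apply: measurable_bounded_integrable => //.
- by rewrite (le_lt_trans (probability_le1 _ _)) // ltry.
- exact: measurable_comp_Omega.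
exists C; split; first exact: num_real.
by move=> x Cx w _ /=; apply: le_trans (fC _) (ltW Cx).
Qed.

Lemma EE_cst (c : R) : EE (fun=> c) = c.
Proof.
rewrite /EE Rintegral_cst // -[RHS]mulr1; congr (_ * _).
by rewrite -[RHS]/(fine 1%E); congr fine; apply: probability_setT.
Qed.

Lemma EED f g : bmeas f -> bmeas g -> EE (fun X => f X + g X) = EE f + EE g.
Proof. by move=> mf mg; apply: RintegralD => //; apply: bmeas_integrable. Qed.

Lemma EEB f g : bmeas f -> bmeas g -> EE (fun X => f X - g X) = EE f - EE g.
Proof. by move=> mf mg; apply: RintegralB => //; apply: bmeas_integrable. Qed.

Lemma EEZ c f : bmeas f -> EE (fun X => c * f X) = c * EE f.
Proof. by move=> mf; apply: RintegralZl => //; apply: bmeas_integrable. Qed.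

Lemma EE_sum (I : eqType) (s : seq I) (f : I -> MX -> R) :
  (forall i, i \in s -> bmeas (f i)) ->
  EE (fun X => \sum_(i <- s) f i X) = \sum_(i <- s) EE (f i).
Proof.
elim: s => [|i s IH] mf.
  by rewrite big_nil -[RHS](EE_cst 0); congr EE; apply/funext => X; rewrite big_nil.
have ms a : a \in s -> bmeas (f a) by move=> sa; apply: mf; rewrite inE sa orbT.
rewrite big_cons -IH // -EED; last exact: bmeas_sum.
  by congr EE; apply/funext => X; rewrite big_cons.
by apply: mf; rewrite mem_head.
Qed.

(** The difference [g - f] agrees almost everywhere with its absolute value, whose integral is
    nonnegative. *)
Lemma EE_le_ae f g : bmeas f -> bmeas g ->
  {ae P, forall w, f (Omega w) <= g (Omega w)} -> EE f <= EE g.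
Proof.
move=> mf mg fg; rewrite -subr_ge0 -EEB //.
have mgf := bmeasB mg mf; have [mgf' [C gfC]] := mgf.
have mh : bmeas (fun X => `|g X - f X|).
  split; first exact: (measurableT_comp (@normr_measurable R setT)).
  by exists C => X; rewrite normr_id.
suff -> : EE (fun X => g X - f X) = EE (fun X => `|g X - f X|) by apply: Rintegral_ge0.
rewrite /EE /Rintegral; congr fine; apply: ae_eq_integral => //.
- by apply/measurable_EFinP; apply: (measurable_comp_Omega mgf').
- by apply/measurable_EFinP; apply: (measurable_comp_Omega mh.1).
by apply: filterS fg => w fgw _; rewrite ger0_norm // subr_ge0.
Qed.

Lemma EE_le f g : bmeas f -> bmeas g -> (forall X, f X <= g X) -> EE f <= EE g.
Proof. by move=> mf mg fg; apply: EE_le_ae => //; apply: aeW. Qed.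

Lemma EE_ge0 f : (forall X, 0 <= f X) -> 0 <= EE f.
Proof. by move=> f0; apply: Rintegral_ge0. Qed.

Lemma bmeas_unitary f (U : 'M[K]_n) : bmeas f -> bmeas (fun X => f (U *m X : 'M[K]_(n, l))).
Proof.
move=> [mf [C fC]]; split; last by exists C.
exact: (measurableT_comp mf (measurable_mulmx U)).
Qed.

(** Both sides are integrals of [f] against the laws of [U Omega] and [Omega], which agree on
    measurable sets. *)
Lemma EE_unitary f (U : 'M[K]_n) : is_unitaryK U -> bmeas f ->
  EE (fun X => f (U *m X : 'M[K]_(n, l))) = EE f.
Proof.
move=> hU mf; have mfU := bmeas_unitary U mf.
have mUO : measurable_fun setT (fun w => U *m (Omega w : 'M[K]_(n, l)) : MX).
  exact: (measurableT_comp (measurable_mulmx U)).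
pose UO : {RV P >-> MX} := HB.pack (fun w => U *m (Omega w : 'M[K]_(n, l)) : MX)
  (isMeasurableFun.Build _ _ _ _ _ mUO).
rewrite /EE /Rintegral; congr fine.
have mEf : measurable_fun setT (EFin \o f) by apply/measurable_EFinP; case: mf.
transitivity (\int[distribution P UO]_X (f X)%:E)%E.
  by rewrite (integral_distribution mEf) //; apply: (bmeas_integrable mfU).
transitivity (\int[distribution P Omega]_X (f X)%:E)%E; last first.
  by rewrite (integral_distribution mEf) //; apply: (bmeas_integrable mf).
apply: eq_measure_integral => B mB _.
by symmetry; apply: (invariant hU).
Qed.

End Expectation.

(** * Almost sure rank of a row compression *)

Section PlaneRotations.
Context (R : realType) (k : scalars) (n : nat).
Local Notation K := (fieldK R k).
Local Notation "x %:K" := (@ofRealK R k x) (at level 2, format "x %:K").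
Local Notation adj := (@adjmx R k _ _).
Local Notation ev := (@ev R k n).

(** With the slope [t] as parameter, the only irrational quantity is [c], and Hermitian forms see it
    only through [c ^+ 2 = 1 / (1 + t ^+ 2)]: rotated entries are rational in [t]. *)
Lemma slope_rotation (i j : 'I_n) (t : R) (w : K) (c := (Num.sqrt (1 + t ^+ 2))^-1) :
  i != j -> normK2 w = 1 ->
  exists U : 'M[K]_n, [/\ is_unitaryK U,
    forall m : nat, m != i -> m != j -> U *m ev m = ev m,
    adj U *m ev j = c%:K *: (ev j + (t%:K * w) *: ev i)
    & adj U *m ev i = c%:K *: (ev i - (t%:K * conjK w) *: ev j)].
Proof.
move=> ij w1; have t1 : 0 < 1 + t ^+ 2 by rewrite ltr_pwDl // sqr_ge0.
have c2 : c ^+ 2 = (1 + t ^+ 2)^-1 by rewrite exprVn sqr_sqrtr // ltW.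
have [|U [hU Uj Ui Um]] := @plane_rotation R k n i j c (c%:K * (t%:K * w)) ij.
  by rewrite !normK2M !normK2_ofReal w1 mulr1 c2; field; rewrite gt_eqF.
exists (adj U); split; rewrite ?adjmxK.
- exact: unitary_adj.
- by move=> m mi mj; rewrite -{1}(Um m mi mj) mulmxA unitaryCK // mul1mx.
- by rewrite Uj scalerDr scalerA.
- rewrite Ui !rmorphM /= !conjK_ofReal scalerBr scalerA addrC; congr (_ + _).
  by rewrite scaleNr.
Qed.

End PlaneRotations.

Section TraceAlmostSurely.
Local Open Scope classical_set_scope.
Context (R : realType) (k : scalars) (n l : nat).
Local Notation K := (fieldK R k).
Local Notation "x %:K" := (@ofRealK R k x) (at level 2, format "x %:K").
Local Notation adj := (@adjmx R k _ _).
Local Notation MX := (borelmx R k n l).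
Local Notation ev := (@ev R k n).
Context (disp : measure_display) (T : measurableType disp) (P : probability T R).
Variable Omega : {RV P >-> MX}.
Hypothesis invariant : forall U : 'M[K]_n, is_unitaryK U ->
  eq_in_distribution P Omega (fun w => U *m (Omega w : 'M[K]_(n, l)) : MX).
Hypothesis le_ln : (l <= n)%N.
Hypothesis full_rank : {ae P, forall w, \rank (Omega w : 'M[K]_(n, l)) = l}.

Local Notation cop X r := (coproj (X : 'M[K]_(n, l)) r).

Lemma mulmx_unitary_col (U Q : 'M[K]_n) (v : 'cV[K]_n) : is_unitaryK U ->
  nrm2 (U *m Q *m adj U *m v) = nrm2 (Q *m (adj U *m v)).
Proof. by move=> hU; rewrite -!mulmxA nrm2_unitaryl. Qed.

Lemma measurable_coproj_ev r i : measurable_fun setT (fun X : MX => nrm2 (cop X r *m ev i)).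
Proof.
by apply: measurable_nrm2; apply: measmx_M; [apply: measmx_coproj|apply: measmx_cst].
Qed.

(* The indicator of [coproj X r.+1 *m ev r = 0 /\ coproj X r.+1 *m ev j <> 0],
   written with the convention [0 / 0 = 0]. *)
Definition degenerate (r : nat) (j : nat) (X : MX) : R :=
  let a := nrm2 (cop X r.+1 *m ev r) in let b := nrm2 (cop X r.+1 *m ev j) in
  (1 - a / a) * (b / b).

Lemma divff01 (x : R) : x / x = (x != 0)%:R.
Proof. by have [->|x0] := eqVneq x 0; rewrite ?mul0r ?mulfV. Qed.

Lemma degenerateE r j X :
  degenerate r j X = ((nrm2 (cop X r.+1 *m ev r) == 0) && (nrm2 (cop X r.+1 *m ev j) != 0))%:R.
Proof.
rewrite /degenerate !divff01; case: eqP => _ /=; last by rewrite subrr mul0r.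
by rewrite subr0 mul1r.
Qed.

Lemma bmeas_degenerate r j : bmeas (degenerate r j).
Proof.
split; last first.
  by exists 1 => X; rewrite degenerateE; case: (_ && _); rewrite ?normr1 ?normr0 ?ler01.
have m i := measurable_coproj_ev r.+1 i.
have q i : measurable_fun setT (fun X : MX =>
    nrm2 (cop X r.+1 *m ev i) / nrm2 (cop X r.+1 *m ev i)).
  by apply: measurable_funM => //; apply: measurable_inv_ge0 => // X; apply: nrm2_ge0.
by apply: measurable_funM => //; apply: measurable_funB => //; apply: measurable_cst.
Qed.

Lemma sum_exclusive (N : nat) (p : pred 'I_N) :
  (forall a b, p a -> p b -> a = b) -> \sum_(a < N) (p a)%:R <= 1 :> R.
Proof.
move=> h; have [a pa|p0] := pickP p; last by rewrite big1 ?ler01 // => a _; rewrite p0.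
rewrite (bigD1 a) //= pa big1 ?addr0 // => b ba; case pb: (p b) => //.
by rewrite (h a b pa pb) eqxx in ba.
Qed.

(* Rotating the plane of [ev r] and [ev j] by different angles gives disjoint events. *)
Lemma EE_degenerate_le (r : nat) (j : 'I_n) (rn : (r < n)%N) (N : nat) :
  (j < r)%N -> N%:R * EE Omega (degenerate r j) <= 1.
Proof.
move=> jr; have jr' : j != Ordinal rn by rewrite -val_eqE /= ltn_eqF.
have w1 : normK2 (1 : K) = 1 by apply: normK2_phase; apply: one_phasesK.
pose rot m U := [/\ is_unitaryK U,
    forall m : nat, m != j -> m != Ordinal rn -> U *m ev m = ev m,
    adj U *m ev r = (Num.sqrt (1 + m%:R ^+ 2))^-1%:K *: (ev r + (m%:R%:K * 1) *: ev j)
  & adj U *m ev j = (Num.sqrt (1 + m%:R ^+ 2))^-1%:K *: (ev j - (m%:R%:K * conjK 1) *: ev r)].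
have /boolp.choice[U hU] : forall m : 'I_N, exists U, rot m U.
  by move=> m; apply: (@slope_rotation R k n j (Ordinal rn) m%:R 1 jr' w1).
have mb m : bmeas (fun X : MX => degenerate r j (U m *m (X : 'M[K]_(n, l)))).
  exact: (bmeas_unitary (U m) (bmeas_degenerate r j)).
have -> : N%:R * EE Omega (degenerate r j) =
    EE Omega (fun X : MX => \sum_(m < N) degenerate r j (U m *m (X : 'M[K]_(n, l)))).
  rewrite EE_sum // -[X in X%:R]card_ord mulr_natl -sumr_const.
  apply: eq_bigr => m _; have [Um _ _ _] := hU m.
  by rewrite (EE_unitary invariant Um (bmeas_degenerate r j)).
rewrite -[leRHS](EE_cst Omega 1).
apply: EE_le; [by apply: bmeas_sum => m _; apply: mb|exact: bmeas_cst|move=> X].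
under eq_bigr do rewrite degenerateE.
apply: sum_exclusive => a b.
(* With [Q = coproj X r.+1], the event for slope [m] forces [Q e_r = - m Q e_j]. Two distinct slopes
   give [Q e_j = Q e_r = 0], which contradicts the second half of the event. *)
have key (m : 'I_N) : nrm2 (cop (U m *m (X : 'M[K]_(n, l))) r.+1 *m ev r) == 0 ->
    cop X r.+1 *m ev r + m%:R%:K *: (cop X r.+1 *m ev j) = 0.
  have [Um fU Ur _] := hU m.
  rewrite coproj_equiv // => [|i ri]; last first.
    by apply: fU; rewrite /= gtn_eqF // (ltn_trans jr).
  rewrite mulmx_unitary_col // Ur mulr1 -scalemxAr nrm2Z normK2_ofReal.
  rewrite mulf_eq0 sqrf_eq0 invr_eq0 gt_eqF /=; last first.
    by rewrite sqrtr_gt0 ltr_pwDl // sqr_ge0.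
  by rewrite mulmxDr -scalemxAr => /eqP /nrm2_eq0.
move=> /andP[/key ka nb] /andP[/key kb _]; apply/val_inj => /=.
apply/eqP; rewrite -(eqr_nat R) -subr_eq0; apply: contraT => ab.
have Qj : cop X r.+1 *m ev j = 0.
  have : (a%:R - b%:R)%:K *: (cop X r.+1 *m ev j) = 0.
    rewrite rmorphB scalerBl; apply/eqP; rewrite subr_eq0; apply/eqP.
    by apply: (addrI (cop X r.+1 *m ev r)); rewrite ka kb.
  move/eqP; rewrite scaler_eq0 fmorph_eq0 (negbTE ab) /= => /eqP //.
have Qr : cop X r.+1 *m ev r = 0 by move: ka; rewrite Qj scaler0 addr0.
move: nb; have [Ua fU _ Uj] := hU a.
rewrite coproj_equiv // => [|i ri]; last first.
  by apply: fU; rewrite /= gtn_eqF // (ltn_trans jr).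
rewrite mulmx_unitary_col // Uj -scalemxAr mulmxBr -scalemxAr Qj Qr !scaler0 subrr scaler0.
by rewrite nrm2_0 eqxx.
Qed.

(** The previous bound for every [N] makes the expectation of the indicator zero, and a nonnegative
    function with zero integral vanishes almost everywhere. *)
Lemma degenerate_ae (r : nat) (j : 'I_n) : (r < n)%N -> (j < r)%N ->
  {ae P, forall w, nrm2 (cop (Omega w) r.+1 *m ev r) = 0 ->
    cop (Omega w) r.+1 *m ev j = 0}.
Proof.
move=> rn jr; have mg := bmeas_degenerate r j.
have g0 X : 0 <= degenerate r j X by rewrite degenerateE.
have E0 : EE Omega (degenerate r j) = 0.
  apply/eqP; rewrite eq_le EE_ge0 // andbT leNgt; apply/negP => E_gt0.
  have [N] := ltr_add_invr E_gt0.
  rewrite add0r => hN; have := EE_degenerate_le rn N.+1 jr.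
  by rewrite leNgt mulrC -ltr_pdivrMr ?ltr0n // div1r hN.
have /(ae_eq_integral_abs P measurableT) :
    measurable_fun setT (fun w => (degenerate r j (Omega w))%:E).
  by apply/measurable_EFinP; apply: measurable_comp_Omega; case: mg.
case=> + _; have -> : (\int[P]_w `|(degenerate r j (Omega w))%:E| = 0)%E.
  under eq_integral do rewrite abse_EFin ger0_norm //.
  rewrite -[LHS]fineK; first by rewrite -[RHS]/(0%:E) -E0.
  exact: (integrable_fin_num measurableT (bmeas_integrable Omega mg)).
move=> /(_ erefl); apply: filterS => w /(_ I) /= /eqP.
rewrite eqe degenerateE pnatr_eq0 eqb0 => + a0.
by rewrite a0 eqxx /= negbK => /eqP /nrm2_eq0.
Qed.

(** Downward induction on the dimension [r = n - i]. Removing [ev r] lowers the trace by one unless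
    the projector kills [ev r]; in that case it almost surely kills every [ev j], so it is zero and
    the bound holds because [l <= r]. *)
Lemma coproj_trace_ae i : (i <= n - l)%N ->
  {ae P, forall w, rtr (cop (Omega w) (n - i)) <= (n - i)%:R - l%:R}.
Proof.
elim: i => [_|i IH il].
  by rewrite subn0; apply: filterS full_rank => w; apply: coproj_rtr.
have lin : (i < n)%N by apply: leq_trans il (leq_subr _ _).
have rn : (n - i.+1 < n)%N by rewrite ltn_subrL /= (leq_ltn_trans _ lin).
have lr : (l <= n - i.+1)%N by rewrite leq_subRL // addnC -leq_subRL.
have ri : (n - i = (n - i.+1).+1)%N by rewrite subnSK.
have := IH (ltnW il); rewrite ri; set r := (n - i.+1)%N in rn lr *.
have all_j : {ae P, forall w, forall j : 'I_n, nrm2 (cop (Omega w) r.+1 *m ev r) = 0 ->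
    cop (Omega w) r.+1 *m ev j = 0}.
  apply: filter_forall => j; have [jr|] := ltnP j r; first exact: degenerate_ae.
  rewrite leq_eqVlt => /predU1P[<-|rj]; first by apply: aeW => w /nrm2_eq0.
  by apply: aeW => w _; apply: coproj_ev.
apply: filterS2 all_j => w h htr.
rewrite coprojS // shrink_tr; have [a0|a1] := eqVneq; last first.
  by rewrite lerBlDr (le_trans htr) // -natr1 /=; lra.
suff -> : cop (Omega w) r.+1 = 0 by rewrite /= subr0 /rtr !raddf0 subr_ge0 ler_nat.
apply/matrixP => i1 j; have /colP/(_ i1) := h j a0.
by rewrite mulmx_evE !mxE.
Qed.

End TraceAlmostSurely.

(** * The integration by parts identity *)

Section QuotientExpansion.
Context (R : realType).
Implicit Types (t e B : R).

(** A first-order Taylor formula whose remainder depends on the coefficients only through [B] and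
    [e]. The remainder is exactly [t ^+ 2] times a fraction of denominator [H * A], which is at
    least [e ^+ 2]. *)
Lemma quotient_expansion (A h1 h2 p0 p1 p2 t e B : R) (H := A + t * h1 + t ^+ 2 * h2) :
  0 < e -> e <= A -> e <= H -> 0 <= t <= 1 ->
  A <= B -> `|h1| <= B -> `|h2| <= B -> `|p0| <= B -> `|p1| <= B -> `|p2| <= B ->
  `|(p0 + t * p1 + t ^+ 2 * p2) / H - p0 / A - t * (p1 / A - p0 * h1 / A ^+ 2)|
    <= t ^+ 2 * ((4 * B ^+ 3 / e + 2 * B ^+ 2) / e ^+ 2).
Proof.
move=> e0 eA eH /andP[t0 t1] AB h1B h2B p0B p1B p2B.
have A0 : 0 < A by apply: lt_le_trans eA.
have H0 : 0 < H by apply: lt_le_trans eH.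
have -> : (p0 + t * p1 + t ^+ 2 * p2) / H - p0 / A - t * (p1 / A - p0 * h1 / A ^+ 2) =
    t ^+ 2 * ((p2 * A - p0 * h2 - (p1 * A - p0 * h1) * (h1 + t * h2) / A) / (H * A)).
  by rewrite /H; field; rewrite !gt_eqF.
have B0 : 0 <= B by apply: le_trans AB; apply: ltW.
rewrite normrM [`|t ^+ 2|]ger0_norm ?sqr_ge0 // ler_wpM2l ?sqr_ge0 //.
have HA0 : 0 <= H * A by rewrite mulr_ge0 // ltW.
rewrite normrM normfV [`|H * A|]ger0_norm //.
have prodB (a b c d : R) : `|a| <= c -> `|b| <= d -> `|a * b| <= c * d.
  by move=> ac bd; rewrite normrM ler_pM.
have nA : `|A| <= B by rewrite gtr0_norm.
have g1 : `|p2 * A - p0 * h2| <= 2 * B ^+ 2.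
  have -> : 2 * B ^+ 2 = B * B + B * B by ring.
  by rewrite (le_trans (ler_normB _ _)) // lerD //; apply: prodB.
have g2 : `|p1 * A - p0 * h1| <= 2 * B ^+ 2.
  have -> : 2 * B ^+ 2 = B * B + B * B by ring.
  by rewrite (le_trans (ler_normB _ _)) // lerD //; apply: prodB.
have g3 : `|h1 + t * h2| <= 2 * B.
  have -> : 2 * B = B + 1 * B by ring.
  by rewrite (le_trans (ler_normD _ _)) // lerD //; apply: prodB; rewrite // ger0_norm.
have g4 : `|(p1 * A - p0 * h1) * (h1 + t * h2) / A| <= 4 * B ^+ 3 / e.
  have -> : 4 * B ^+ 3 = 2 * B ^+ 2 * (2 * B) by ring.
  have := prodB _ A^-1 _ e^-1 (prodB _ _ _ _ g2 g3); apply.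
  by rewrite ger0_norm ?invr_ge0 ?lef_pV2 ?posrE // ltW.
apply: ler_pM => //; first by rewrite invr_ge0.
  by rewrite (le_trans (ler_normB _ _)) // addrC lerD.
by rewrite lef_pV2 ?posrE ?mulr_gt0 ?exprn_gt0 // expr2 ler_pM // ltW.
Qed.

Lemma norm_sum6_le (M u1 u2 u3 u4 u5 u6 : R) :
  `|u1| <= M -> `|u2| <= M -> `|u3| <= M -> `|u4| <= M -> `|u5| <= M -> `|u6| <= M ->
  `|- u1 + 2 * u2 + u3 - 2 * u4 + u5 - u6| <= 8 * M.
Proof.
rewrite !ler_norml => /andP[? ?] /andP[? ?] /andP[? ?] /andP[? ?] /andP[? ?] /andP[? ?].
by apply/andP; split; lra.
Qed.

(** Here [a], [c], [b] stand for [P_jj], [P_ii], [Re (w P_ji)], and [x], [z], [y] for the same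
    entries of [M]; [s] is the squared cosine of the rotation. The left factor of [t] is the
    derivative at slope zero. *)
Lemma rotation_expansion (a c b x y z t e M : R) (s := (1 + t ^+ 2)^-1)
    (B := 8 * M + 8 + 4 * e) :
  0 < e -> 0 <= a <= 1 -> 0 <= c <= 1 -> `|b| <= 1 -> `|x| <= M -> `|z| <= M -> `|y| <= M ->
  0 <= t <= 1 -> 0 <= a + 2 * t * b + t ^+ 2 * c ->
  `|s * (b + t * (c - a) - t ^+ 2 * b) * (s * (x + 2 * t * y + t ^+ 2 * z)) /
      (s * (a + 2 * t * b + t ^+ 2 * c) + e) - b * x / (a + e) -
    t * (((c - a) * x + 2 * b * y) / (a + e) - b * x * (2 * b) / (a + e) ^+ 2)|
  <= t ^+ 2 * ((4 * B ^+ 3 / e + 2 * B ^+ 2) / e ^+ 2).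
Proof.
move=> e0 /andP[a0 a1] /andP[c0 c1] hb hx hz hy t01 pos; have /andP[t0 t1] := t01.
have tt : 0 < 1 + t ^+ 2 by rewrite ltr_pwDl // sqr_ge0.
have t2 : 0 <= t ^+ 2 by apply: sqr_ge0.
have t21 : t ^+ 2 <= 1 by rewrite expr_le1.
have small (u v m : R) : `|u| <= 1 -> `|v| <= m -> `|u * v| <= m.
  by move=> hu hv; rewrite normrM -[leRHS]mul1r ler_pM.
have nt : `|t| <= 1 by rewrite ger0_norm.
have nt2 : `|t ^+ 2| <= 1 by rewrite ger0_norm.
have nca : `|c - a| <= 1 by rewrite ler_norml; apply/andP; split; lra.
have M0 : 0 <= M by apply: le_trans hx.
(* The rotated pivot is [s * D], so the quotient has denominator [(1 + t ^+ 2) * D]. This is put in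
   the form [A + t * h1 + t ^+ 2 * h2] by letting [h2] contain [D], which depends on [t] but stays
   bounded. *)
pose D := a + 2 * t * b + t ^+ 2 * c + (1 + t ^+ 2) * e.
have D_ge : e <= D.
  have -> : D = e + (a + 2 * t * b + t ^+ 2 * c + t ^+ 2 * e) by rewrite /D; ring.
  by rewrite lerDl addr_ge0 // mulr_ge0 // ltW.
have D0 : 0 <= D by apply: le_trans D_ge; apply: ltW.
have De : D <= 4 + 2 * e.
  have h1 : t * b <= 1 by apply: le_trans (ler_norm _) _; apply: small.
  have h2 : t ^+ 2 * c <= 1 by rewrite mulr_ile1.
  have h3 : t ^+ 2 * e <= e by rewrite ler_piMl // ltW.
  rewrite /D; have -> : a + 2 * t * b + t ^+ 2 * c + (1 + t ^+ 2) * e =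
    a + 2 * (t * b) + t ^+ 2 * c + (e + t ^+ 2 * e) by ring.
  lra.
(* All terms of degree two to four of the numerator, divided by [t ^+ 2]. *)
pose p2 := - (b * x) + 2 * ((c - a) * y) + b * z - 2 * (t * (b * y)) + t * ((c - a) * z)
  - t ^+ 2 * (b * z).
have HE : (a + e) + t * (2 * b) + t ^+ 2 * (c + e + D) = (1 + t ^+ 2) * D.
  by rewrite /D; ring.
have hM : 8 * M <= B by rewrite /B; lra.
have := @quotient_expansion (a + e) (2 * b) (c + e + D) (b * x)
  ((c - a) * x + 2 * (b * y)) p2 t e B e0; rewrite HE.
have -> : (b * x + t * ((c - a) * x + 2 * (b * y)) + t ^+ 2 * p2) / ((1 + t ^+ 2) * D) =
    s * (b + t * (c - a) - t ^+ 2 * b) * (s * (x + 2 * t * y + t ^+ 2 * z)) /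
      (s * (a + 2 * t * b + t ^+ 2 * c) + e).
  have -> : s * (a + 2 * t * b + t ^+ 2 * c) + e = s * D.
    by rewrite /s /D; field; rewrite gt_eqF.
  rewrite /s /p2; field; rewrite !gt_eqF //; exact: lt_le_trans D_ge.
rewrite [2 * (b * y)]mulrA; apply=> //.
- by rewrite lerDr.
- by rewrite (le_trans D_ge) // mulrDl mul1r lerDl mulr_ge0.
- by rewrite /B; lra.
- by rewrite normrM gtr0_norm // /B; lra.
- have h0 : 0 <= c + e + D by rewrite addr_ge0 // addr_ge0 // ltW.
  by rewrite ger0_norm // /B; lra.
- by apply: le_trans (small _ _ _ hb hx) _; rewrite /B; lra.
- have h1 := small _ _ _ nca hx; have h2 := small _ _ _ hb hy.
  apply: le_trans (ler_normD _ _) _; rewrite -mulrA [`|2 * _|]normrM gtr0_norm //.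
  by rewrite /B; lra.
- apply: le_trans hM; apply: norm_sum6_le; do ?apply: (small) => //.
Qed.

(** For [e = 0] and [a > 0] the right side equals [(b * tr - 2) * x / a - b * m * x], so only
    [p <= tr] is used; for [e > 0] the regularization errors have the favourable sign. *)
Lemma stein_pointwise (a x e p tr m : R) (b : nat) :
  0 < e -> 0 <= x -> 0 <= a -> a <= 1 -> 0 <= m -> p <= tr ->
  (b%:R * p - 2) * (x / (a + e)) - b%:R * m * x <=
  (b%:R * ((tr - m * a) * x) - 2 * a * x) / (a + e) - 2 * x * (a - a ^+ 2) / (a + e) ^+ 2.
Proof.
move=> e0 x0 a0 a1 m0 ptr; have ae : 0 < a + e by rewrite ltr_wpDl.
have i0 : 0 <= (a + e)^-1 by rewrite invr_ge0 ltW.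
(* The difference of the two sides is a sum of three nonnegative terms: the excess of the trace over
   [p], and two terms proportional to [e]. *)
rewrite -subr_ge0; have -> : (b%:R * ((tr - m * a) * x) - 2 * a * x) / (a + e) -
    2 * x * (a - a ^+ 2) / (a + e) ^+ 2 -
    ((b%:R * p - 2) * (x / (a + e)) - b%:R * m * x) =
    b%:R * (tr - p) * x / (a + e) + b%:R * m * x * e / (a + e) +
    2 * x * (1 - a) * e / (a + e) / (a + e).
  by field; rewrite gt_eqF.
have b0 : 0 <= b%:R :> R by apply: ler0n.
by rewrite !addr_ge0 // !mulr_ge0 ?subr_ge0 // ltW.
Qed.

End QuotientExpansion.

(** * Positive semidefinite matrices and their entries along a plane rotation *)

Section FormBounds.
Context (R : realType) (k : scalars) (n : nat).
Local Notation K := (fieldK R k).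
Local Notation "x %:K" := (@ofRealK R k x) (at level 2, format "x %:K").
Local Notation adj := (@adjmx R k _ _).
Local Notation ev := (@ev R k n).
Implicit Types (H Q E : 'M[K]_n) (u v : 'cV[K]_n).

Definition nonneg_form H : Prop := adj H = H /\ forall v, exists a, 0 <= a /\ form H v v = a%:K.

Lemma nonneg_form_gram m (B : 'M[K]_(n, m)) : nonneg_form (B *m adj B).
Proof.
split=> [|v]; first by rewrite adjmxM adjmxK.
by exists (nrm2 (adj B *m v)); rewrite nrm2_ge0 form_gram.
Qed.

Lemma nonneg_form_hproj Q : hproj Q -> nonneg_form Q.
Proof. by move=> [hQ QQ]; rewrite -QQ -{2}hQ; apply: nonneg_form_gram. Qed.

Lemma nonneg_diag_ge0 H i : nonneg_form H -> 0 <= reK (H i i).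
Proof. by move=> [_ /(_ (ev i))[a [a0]]]; rewrite form_ev => ->; rewrite reK_ofReal. Qed.

Lemma nonneg_diag H i : nonneg_form H -> H i i = (reK (H i i))%:K.
Proof. by move=> [_ /(_ (ev i))[a [a0]]]; rewrite form_ev => ->; rewrite reK_ofReal. Qed.

Lemma herm_entry H i j : adj H = H -> H j i = conjK (H i j).
Proof. by move=> hH; rewrite -adjmxE hH. Qed.

Lemma form_slope H (i j : 'I_n) (t : R) (w : K) :
  nonneg_form H -> normK2 w = 1 ->
  reK (form H (ev i + (t%:K * w) *: ev j) (ev i + (t%:K * w) *: ev j)) =
  reK (H i i) + 2 * t * reK (w * H i j) + t ^+ 2 * reK (H j j).
Proof.
move=> hH w1; rewrite -[ev i]scale1r form_lin !form_ev.
rewrite (herm_entry i j hH.1) (nonneg_diag i hH) (nonneg_diag j hH) !reK_ofReal.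
rewrite /normK2 in w1.
rewrite !raddfD /= !(reKM, imKM, rmorph1, rmorphM, conjK_ofReal, reK_conj, imK_conj,
  reK_ofReal, imK_ofReal) /=.
have -> : reK (1 : K) = 1 by rewrite -(rmorph1 (@ofRealK R k)) reK_ofReal.
have -> : imK (1 : K) = 0 by rewrite -(rmorph1 (@ofRealK R k)) imK_ofReal.
(* Inserting [|w|^2 = 1] in front of [reK (H j j)] makes the equation a polynomial identity. *)
have e (x : R) : x = (reK w ^+ 2 + imK w ^+ 2) * x by rewrite w1 mul1r.
rewrite [X in _ = _ + _ * X]e; ring.
Qed.

(** The two vectors are, up to the common factor [c], the rotated basis vectors of
    [slope_rotation]. *)
Lemma form_slope_cross H (i j : 'I_n) (t : R) (w : K) :
  nonneg_form H -> normK2 w = 1 ->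
  reK (w * form H (ev i + (t%:K * w) *: ev j) (ev j - (t%:K * conjK w) *: ev i)) =
  reK (w * H i j) + t * (reK (H j j) - reK (H i i)) - t ^+ 2 * reK (w * H i j).
Proof.
move=> hH w1; have -> : ev j - (t%:K * conjK w) *: ev i = (- (t%:K * conjK w)) *: ev i + 1 *: ev j.
  by rewrite scale1r addrC scaleNr.
rewrite -[X in form _ (X + _)]scale1r form_lin !form_ev.
rewrite (herm_entry i j hH.1) (nonneg_diag i hH) (nonneg_diag j hH) !reK_ofReal.
rewrite /normK2 in w1.
rewrite !(mulrDr, raddfD) /= !(reKM, imKM, rmorph1, rmorphM, conjK_ofReal, reK_conj, imK_conj,
  reK_ofReal, imK_ofReal, raddfN) /=.
have -> : reK (1 : K) = 1 by rewrite -(rmorph1 (@ofRealK R k)) reK_ofReal.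
have -> : imK (1 : K) = 0 by rewrite -(rmorph1 (@ofRealK R k)) imK_ofReal.
rewrite ?(reKM, imKM, conjK_ofReal, reK_conj, imK_conj, reK_ofReal, imK_ofReal).
pose b := reK w * reK (H i j) - imK w * imK (H i j).
transitivity (b + (reK w ^+ 2 + imK w ^+ 2) * (t * (reK (H j j) - reK (H i i)) - t ^+ 2 * b)).
  by rewrite /b; ring.
by rewrite w1 /b; ring.
Qed.

End FormBounds.

Section Rotated.
Context (R : realType) (k : scalars) (n : nat).
Local Notation K := (fieldK R k).
Local Notation "x %:K" := (@ofRealK R k x) (at level 2, format "x %:K").
Local Notation adj := (@adjmx R k _ _).
Local Notation ev := (@ev R k n).
Implicit Types (H Q E U : 'M[K]_n).

Lemma form_scale H u v (c : R) : form H (c%:K *: u) (c%:K *: v) = (c ^+ 2)%:K * form H u v.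
Proof.
by rewrite /form adjmxZ conjK_ofReal -!scalemxAl -scalemxAr scalerA mxE -rmorphM.
Qed.

Lemma gram_equiv U E : is_unitaryK U ->
  (U *m E *m adj U) *m adj (U *m E *m adj U) = U *m (E *m adj E) *m adj U.
Proof.
move=> hU; rewrite (adjmxM _ (adj U)) adjmxK (adjmxM U E) !mulmxA.
by rewrite -(mulmxA (U *m E) (adj U) U) unitaryCK // mulmx1.
Qed.

Lemma rotated_entries H U (i j : 'I_n) (c t : R) (w : K) :
  nonneg_form H -> normK2 w = 1 ->
  adj U *m ev i = c%:K *: (ev i + (t%:K * w) *: ev j) ->
  adj U *m ev j = c%:K *: (ev j - (t%:K * conjK w) *: ev i) ->
  reK ((U *m H *m adj U) i i) =
    c ^+ 2 * (reK (H i i) + 2 * t * reK (w * H i j) + t ^+ 2 * reK (H j j)) /\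
  reK (w * (U *m H *m adj U) i j) =
    c ^+ 2 * (reK (w * H i j) + t * (reK (H j j) - reK (H i i)) - t ^+ 2 * reK (w * H i j)).
Proof.
move=> hH w1 Ui Uj; rewrite -!form_ev !form_conj Ui Uj !form_scale; split.
  by rewrite reK_ofRealM form_slope // !form_ev.
by rewrite mulrCA reK_ofRealM form_slope_cross // !form_ev.
Qed.

Lemma nonneg_slope_ge0 H (i j : 'I_n) t (w : K) : nonneg_form H -> normK2 w = 1 ->
  0 <= reK (H i i) + 2 * t * reK (w * H i j) + t ^+ 2 * reK (H j j).
Proof.
move=> hH w1; rewrite -form_slope //.
have [_ /(_ (ev i + (t%:K * w) *: ev j))[a [a0 ->]]] := hH.
by rewrite reK_ofReal.
Qed.

(** The form is nonnegative at the slopes [1] and [-1]. *)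
Lemma nonneg_cross_le H (i j : 'I_n) (w : K) : nonneg_form H -> normK2 w = 1 ->
  `|reK (w * H i j)| <= (reK (H i i) + reK (H j j)) / 2.
Proof.
move=> hH w1.
have := nonneg_slope_ge0 i j 1 hH w1; have := nonneg_slope_ge0 i j (-1) hH w1.
rewrite ler_norml sqrrN !expr1n => h1 h2.
by apply/andP; split; lra.
Qed.

Lemma hproj_diag Q (i : 'I_n) : hproj Q -> reK (Q i i) = nrm2 (Q *m ev i).
Proof. by move=> hQ; rewrite -form_ev form_hproj // reK_ofReal. Qed.

Lemma hproj_diag_le1 Q (i : 'I_n) : hproj Q -> reK (Q i i) <= 1.
Proof.
move=> hQ; rewrite hproj_diag //; have [aQ QQ] := hQ.
rewrite -(nrm2_ev R k i); have -> : nrm2 (ev i) = nrm2 (Q *m ev i) + nrm2 (ev i - Q *m ev i).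
  rewrite -nrm2D_orth ?[_ + (_ - _)]addrC ?subrK //.
  by rewrite mulmxBr adjmxM aQ -!mulmxA (mulmxA Q Q) QQ subrr.
by rewrite lerDl nrm2_ge0.
Qed.

Lemma gram_diag m (B : 'M[K]_(n, m)) (i : 'I_n) :
  reK ((B *m adj B) i i) = nrm2 (adj (ev i) *m B).
Proof.
by rewrite -form_ev form_gram reK_ofReal -[RHS]nrm2_adj adjmxM adjmxK.
Qed.

Lemma nrm2_rows m (B : 'M[K]_(n, m)) : nrm2 B = \sum_(i < n) nrm2 (adj (ev i) *m B).
Proof.
apply: eq_bigr => i _; rewrite adj_ev_mulE /nrm2 big_ord_recl big_ord0 addr0.
by apply: eq_bigr => j _; rewrite mxE.
Qed.

Lemma nrm2_row_le m (B : 'M[K]_(n, m)) (i : 'I_n) : nrm2 (adj (ev i) *m B) <= nrm2 B.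
Proof. by rewrite (nrm2_rows B) (bigD1 i) //= lerDl sumr_ge0 // => a _; apply: nrm2_ge0. Qed.

End Rotated.

Section StateBound.
Context (R : realType) (k : scalars) (n l : nat).
Local Notation K := (fieldK R k).
Variables (eps : R) (r : nat).
Hypothesis eps_gt0 : 0 < eps.

(** The initial norm is the trace of a projector, and each step multiplies the bound by at most
    [1 + 1 / eps] since [a / (a + eps)^2 <= 1 / eps]. The bound degrades as [eps] decreases, but it
    only serves integrability and remainder estimates. *)
Lemma stE_bounded (s : nat) : exists B : R, 0 <= B /\
  forall X : 'M[K]_(n, l), nrm2 (stE eps X r s) <= B.
Proof.
elim: s => [|s [B [B0 hB]]].
  exists (\sum_(i < n) 1); split=> [|X]; first by apply: sumr_ge0.
  have hQ := coproj_hproj X r.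
  rewrite stE0 nrm2_hproj // /rtr /mxtrace raddf_sum /=.
  by apply: ler_sum => i _; apply: hproj_diag_le1.
exists (B + B / eps); split=> [|X]; first by rewrite addr_ge0 // divr_ge0 // ltW.
rewrite stE_nrm2; set a := nrm2 (_ *m _); have a0 : 0 <= a by apply: nrm2_ge0.
apply: lerD => //; rewrite mulrAC mulrC; apply: ler_pM; first exact: nrm2_ge0.
- by rewrite divr_ge0 ?exprn_ge0 // addr_ge0 // ltW.
- have [sn|ns] := ltnP s n; last by rewrite ev_oob // adjmx0 mul0mx nrm2_0.
  exact: le_trans (nrm2_row_le _ (Ordinal sn)) (hB X).
- have ae : 0 < a + eps by rewrite ltr_wpDl.
  rewrite ler_pdivrMr ?exprn_gt0 // mulrC ler_pdivlMr //.
  have := mulr_ge0 a0 a0; have := mulr_ge0 a0 (ltW eps_gt0).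
  have := mulr_ge0 (ltW eps_gt0) (ltW eps_gt0).
  nra.
Qed.

End StateBound.

(** * Differentiation of expectations along plane rotations *)

Section SteinIdentity.
Local Open Scope classical_set_scope.
Context (R : realType) (k : scalars) (n l : nat).
Local Notation K := (fieldK R k).
Local Notation adj := (@adjmx R k _ _).
Local Notation MX := (borelmx R k n l).
Local Notation ev := (@ev R k n).
Context (disp : measure_display) (T : measurableType disp) (P : probability T R).
Variable Omega : {RV P >-> MX}.
Hypothesis invariant : forall U : 'M[K]_n, is_unitaryK U ->
  eq_in_distribution P Omega (fun w => U *m (Omega w : 'M[K]_(n, l)) : MX).
Variables (eps : R) (r q : nat).
Hypotheses (eps_gt0 : 0 < eps) (qn : (q < n)%N).

Let j : 'I_n := Ordinal qn.

Definition projst (X : MX) : 'M[K]_n := stP eps (X : 'M[K]_(n, l)) r q.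
Definition gramst (X : MX) : 'M[K]_n :=
  stE eps (X : 'M[K]_(n, l)) r q *m adj (stE eps (X : 'M[K]_(n, l)) r q).

Lemma gramst_diagE X (i : 'I_n) :
  reK (gramst X i i) = nrm2 (adj (ev i) *m stE eps (X : 'M[K]_(n, l)) r q).
Proof. exact: gram_diag. Qed.

Lemma projst_nonneg X : nonneg_form (projst X).
Proof. exact/nonneg_form_hproj/stP_hproj. Qed.

Lemma gramst_nonneg X : nonneg_form (gramst X).
Proof. exact: nonneg_form_gram. Qed.

Lemma measmx_projst : measmx projst.
Proof. by have [] := measmx_state k n l r q (ltW eps_gt0). Qed.

Lemma measmx_gramst : measmx gramst.
Proof.
have [_ mE] := measmx_state k n l r q (ltW eps_gt0).
by apply: measmx_M => //; apply: measmx_adj.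
Qed.

Lemma projst_diag X i : 0 <= reK (projst X i i) <= 1.
Proof.
by rewrite nonneg_diag_ge0 ?hproj_diag_le1 //; [apply: stP_hproj|apply: projst_nonneg].
Qed.

Lemma measurable_entry (F : MX -> 'M[K]_n) (w : K) a b :
  measmx F -> measurable_fun setT (fun X => reK (w * F X a b)).
Proof. by move=> mF; have [] := measK_M (measK_cst n l w) (mF a b). Qed.

Lemma measurable_diag (F : MX -> 'M[K]_n) a :
  measmx F -> measurable_fun setT (fun X => reK (F X a a)).
Proof. by move=> mF; have [] := mF a a. Qed.

Lemma bmeas_projst_diag i : bmeas (fun X => reK (projst X i i)).
Proof.
split; first exact: (measurable_diag i measmx_projst).
by exists 1 => X; have /andP[h1 h2] := projst_diag X i; rewrite ger0_norm.
Qed.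

Lemma projst_cross X i w : normK2 w = 1 -> `|reK (w * projst X j i)| <= 1.
Proof.
move=> w1; apply: le_trans (nonneg_cross_le j i (projst_nonneg X) w1) _.
have /andP[_ h1] := projst_diag X i; have /andP[_ h2] := projst_diag X j; lra.
Qed.

Lemma bmeas_projst_cross i w : normK2 w = 1 -> bmeas (fun X => reK (w * projst X j i)).
Proof.
move=> w1; split; first exact: measurable_entry measmx_projst.
by exists 1 => X; apply: projst_cross.
Qed.

Lemma gramst_bounded : exists B : R, 0 <= B /\ forall X,
  (forall i, 0 <= reK (gramst X i i) <= B) /\
  (forall i w, normK2 w = 1 -> `|reK (w * gramst X j i)| <= B).
Proof.
have [B [B0 hB]] := stE_bounded k n l r eps_gt0 q.
have hd X i : 0 <= reK (gramst X i i) <= B.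
  by rewrite gramst_diagE nrm2_ge0 (le_trans (nrm2_row_le _ _)).
exists B; split=> // X; split=> // i w w1.
apply: le_trans (nonneg_cross_le j i (gramst_nonneg X) w1) _.
have /andP[_ h1] := hd X i; have /andP[_ h2] := hd X j; lra.
Qed.

Lemma bmeas_gramst_diag i : bmeas (fun X => reK (gramst X i i)).
Proof.
split; first exact: measurable_diag measmx_gramst.
have [B [B0 hB]] := gramst_bounded; exists B => X.
by have [/(_ i)/andP[h1 h2] _] := hB X; rewrite ger0_norm.
Qed.

Lemma bmeas_gramst_cross i w : normK2 w = 1 -> bmeas (fun X => reK (w * gramst X j i)).
Proof.
move=> w1; split; first exact: measurable_entry measmx_gramst.
by have [B [B0 hB]] := gramst_bounded; exists B => X; have [_] := hB X; apply.
Qed.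

Definition pivot (X : MX) : R := reK (projst X j j) + eps.

Lemma pivot_ge X : eps <= pivot X.
Proof. by rewrite lerDr; have /andP[] := projst_diag X j. Qed.

Lemma bmeas_pivot_inv : bmeas (fun X => (pivot X)^-1).
Proof.
apply: (bmeas_inv eps_gt0 pivot_ge).
by have [] := bmeasD (bmeas_projst_diag j) (@bmeas_cst R k n l eps).
Qed.

(** Chosen so that differentiating its first factor yields [P_ii - P_jj], which sums over [i] to the
    trace of [P] up to multiples of the pivot. *)
Definition test_fun (i : 'I_n) (w : K) (X : MX) : R :=
  reK (w * projst X j i) * reK (gramst X j j) / pivot X.

(* Derivative of [test_fun i w] along the rotation of [ev q] towards [w *: ev i]. *)
Definition test_der (i : 'I_n) (w : K) (X : MX) : R :=
  ((reK (projst X i i) - reK (projst X j j)) * reK (gramst X j j) +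
    2 * reK (w * projst X j i) * reK (w * gramst X j i)) / pivot X -
  reK (w * projst X j i) * reK (gramst X j j) * (2 * reK (w * projst X j i)) / pivot X ^+ 2.

Lemma bmeas_test_fun i w : normK2 w = 1 -> bmeas (test_fun i w).
Proof.
move=> w1; apply: bmeasM; last exact: bmeas_pivot_inv.
by apply: bmeasM; [apply: bmeas_projst_cross|apply: bmeas_gramst_diag].
Qed.

Lemma bmeas_test_der i w : normK2 w = 1 -> bmeas (test_der i w).
Proof.
move=> w1; have mb := bmeas_projst_cross i w1; have my := bmeas_gramst_cross i w1.
have mi := bmeas_pivot_inv; have mx := bmeas_gramst_diag j.
rewrite /test_der; under eq_fun do rewrite -exprVn expr2.
apply: bmeasB; apply: bmeasM => //.
- apply: bmeasD; apply: bmeasM => //; last exact: bmeasZ.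
  by apply: bmeasB; apply: bmeas_projst_diag.
- by apply: bmeasM; [apply: bmeasM|apply: bmeasZ].
- exact: bmeasM.
Qed.

(** The rotation moves only [ev q] and [ev i] with [q < i < r], so [state_equiv] makes the rotated
    entries explicit in [t]; the entries are bounded uniformly in [X], hence so is the remainder. *)
Lemma test_fun_expansion (i : 'I_n) (w : K) : normK2 w = 1 -> (q < i < r)%N ->
  exists C : R, 0 <= C /\ forall t : R, 0 <= t <= 1 ->
    exists U : 'M[K]_n, is_unitaryK U /\ forall X : MX,
      `|test_fun i w (U *m (X : 'M[K]_(n, l))) - test_fun i w X - t * test_der i w X| <=
      t ^+ 2 * C.
Proof.
have e0 := eps_gt0; move=> w1 /andP[qi ir]; have ij : i != j by rewrite -val_eqE /= gtn_eqF.
have [M [M0 hM]] := gramst_bounded.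
pose B := 8 * M + 8 + 4 * eps.
exists ((4 * B ^+ 3 / eps + 2 * B ^+ 2) / eps ^+ 2); split.
  have B0 : 0 <= B by rewrite /B; lra.
  by rewrite divr_ge0 ?exprn_ge0 ?addr_ge0 ?divr_ge0 ?mulr_ge0 ?exprn_ge0 // ltW.
move=> t t01; have /andP[t0 t1] := t01.
have [U [hU fU Uj Ui]] := slope_rotation t ij w1.
set c := (Num.sqrt _)^-1 in Uj Ui; have c2 : c ^+ 2 = (1 + t ^+ 2)^-1.
  by rewrite exprVn sqr_sqrtr // addr_ge0 // sqr_ge0.
exists U; split=> // X.
have fixU (m : nat) : (m < q)%N || (r <= m)%N -> U *m ev m = ev m.
  move=> /orP[mq|rm]; apply: fU; rewrite /= ?(ltn_eqF mq) ?(ltn_eqF (ltn_trans mq qi)) //.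
    by rewrite gtn_eqF // (leq_trans ir).
  by rewrite gtn_eqF // (leq_trans _ rm) // (ltn_trans qi).
have [hP hE] := state_equiv eps (X : 'M[K]_(n, l)) hU fixU.
have hP' : projst (U *m (X : 'M[K]_(n, l))) = U *m projst X *m adj U by [].
have hM' : gramst (U *m (X : 'M[K]_(n, l))) = U *m gramst X *m adj U.
  by rewrite /gramst hE gram_equiv.
rewrite /test_fun /pivot hP' hM'.
have [-> ->] := rotated_entries (projst_nonneg X) w1 Uj Ui.
have [-> _] := rotated_entries (gramst_nonneg X) w1 Uj Ui.
rewrite /test_der /pivot.
have pa := projst_diag X j; have pc := projst_diag X i; have pb := projst_cross X i w1.
have pos := nonneg_slope_ge0 j i t (projst_nonneg X) w1.
have [hd hy] := hM X; have hx := hd j; have hz := hd i; have {}hy := hy i w w1.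
move: pa pc pb pos hx hz hy.
move: (reK (projst X j j)) (reK (projst X i i)) (reK (w * projst X j i)).
move: (reK (gramst X j j)) (reK (gramst X i i)) (reK (w * gramst X j i)).
move=> x z y a c' b ha hc hb pos /andP[x0 x1] /andP[z0 z1] hy.
by rewrite c2; apply: rotation_expansion => //; rewrite ger0_norm.
Qed.

(** By invariance the test function and its rotated version have the same expectation, so [t] times
    the expected derivative is of order [t ^+ 2]. *)
Lemma EE_test_der (i : 'I_n) (w : K) : normK2 w = 1 -> (q < i < r)%N -> EE Omega (test_der i w) = 0.
Proof.
move=> w1 qir; have [C [C0 hC]] := test_fun_expansion w1 qir.
have mf := bmeas_test_fun i w1; have md := bmeas_test_der i w1.
set e := EE Omega (test_der i w).
have key t : 0 < t <= 1 -> `|e| <= t * C.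
  move=> /andP[t0 t1]; have [|U [hU hX]] := hC t; first by rewrite ltW.
  have mfU := bmeas_unitary U mf.
  have e1 : EE Omega (fun X => test_fun i w (U *m (X : 'M[K]_(n, l))) - test_fun i w X
      - t * test_der i w X) = - (t * e).
    rewrite EEB ?EEB ?EEZ // ?(EE_unitary invariant) ?subrr ?sub0r //.
      exact: bmeasB.
    exact: bmeasZ.
  have mg : bmeas (fun X => test_fun i w (U *m (X : 'M[K]_(n, l))) - test_fun i w X
      - t * test_der i w X).
    by apply: bmeasB; [apply: bmeasB|apply: bmeasZ].
  have : `|- (t * e)| <= t ^+ 2 * C.
    rewrite -e1 ler_norml -{1}[t ^+ 2 * C](EE_cst Omega) -[X in _ && (_ <= X)](EE_cst Omega).
    rewrite -mulN1r -EEZ; last exact: bmeas_cst.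
    apply/andP; split; apply: EE_le => //; try (by apply: bmeasZ; apply: bmeas_cst);
      try exact: bmeas_cst.
      by move=> X; have := hX X; rewrite mulN1r ler_norml => /andP[].
    by move=> X; have := hX X; rewrite ler_norml => /andP[].
  by rewrite normrN normrM gtr0_norm // expr2 -mulrA ler_pM2l.
apply/eqP; rewrite -normr_eq0; apply: contraT => e0.
have e_gt0 : 0 < `|e| by rewrite lt_def e0 normr_ge0.
have d0 : 0 < `|e| + C + 1 by lra.
(* This value of [t] is at most one and satisfies [t * C < |e|]. *)
have := key (`|e| / (`|e| + C + 1)).
rewrite divr_gt0 //= ler_pdivrMr // mul1r => /(_ ltac:(lra)).
by rewrite -mulrA ler_pMr // mulrC ler_pdivlMr // mul1r; lra.
Qed.

(** * Summation over the planes and the phases *)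

Section SteinSum.
Hypotheses (rn : (r <= n)%N) (qr : (q < r)%N).

Local Notation beta := ((2 - alphaK k)%:R : R).
Local Notation a X := (reK (projst X j j)).
Local Notation x X := (reK (gramst X j j)).

Lemma sum_active (V : zmodType) (f : 'I_n -> V) :
  (forall i : 'I_n, (i < q)%N || (r <= i)%N -> f i = 0) ->
  \sum_i f i = f j + \sum_(i < n | (q < i < r)%N) f i.
Proof.
move=> f0; rewrite (bigD1 j) //=; congr (_ + _).
rewrite [LHS]big_mkcond [RHS]big_mkcond; apply: eq_bigr => i _.
rewrite -val_eqE /=; case: ltngtP => //= qi; last by rewrite f0 // qi.
by case: (ltnP i r) => // ri; rewrite f0 // ri orbT.
Qed.

Lemma projst_inactive X (i i' : 'I_n) : (i < q)%N || (r <= i)%N -> projst X i' i = 0.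
Proof.
move=> qi; have /colP/(_ i') := stP_ev eps (X : 'M[K]_(n, l)) qi.
by rewrite mulmx_evE !mxE.
Qed.

Lemma sum_projst_diag X :
  \sum_(i < n | (q < i < r)%N) reK (projst X i i) = rtr (projst X) - a X.
Proof.
have e : rtr (projst X) = \sum_i reK (projst X i i) by rewrite /rtr /mxtrace raddf_sum.
have := @sum_active _ (fun i => reK (projst X i i)); rewrite -e => -> => [|i qi].
  by rewrite addrC addKr.
by rewrite projst_inactive ?raddf0.
Qed.

(** The diagonal entry at [j] of [P P = P]. *)
Lemma sum_projst_row X :
  \sum_(i < n | (q < i < r)%N) normK2 (projst X j i) = a X - a X ^+ 2.
Proof.
have [hP PP] := stP_hproj eps (X : 'M[K]_(n, l)) r q; rewrite -/(projst X) in hP PP.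
have e : a X = \sum_i normK2 (projst X j i).
  rewrite -{1}PP mxE raddf_sum; apply: eq_bigr => i _ /=.
  by rewrite (herm_entry j i hP) mul_conjK reK_ofReal.
have h := @sum_active _ (fun i => normK2 (projst X j i)).
rewrite [X in X - _]e; apply/eqP; rewrite eq_sym subr_eq addrC; apply/eqP.
rewrite -(@normK2_ofReal R k) -(nonneg_diag j (projst_nonneg X)); apply: h => i qi.
by rewrite projst_inactive // /normK2 !raddf0 expr0n addr0.
Qed.

(** The diagonal entry at [j] of [P M = 0]. *)
Lemma sum_projst_gramst X :
  \sum_(i < n | (q < i < r)%N) reK (projst X j i * conjK (gramst X j i)) = - (a X * x X).
Proof.
have [hM _] := gramst_nonneg X.
have PM : projst X *m gramst X = 0.
  by rewrite /gramst mulmxA /projst stPE mul0mx.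
have e : \sum_i reK (projst X j i * conjK (gramst X j i)) = 0.
  have /matrixP/(_ j j) := PM; rewrite !mxE => /(congr1 (@reK R k)).
  rewrite raddf0 raddf_sum => h; rewrite -[RHS]h.
  by apply: eq_bigr => i _; rewrite (herm_entry j i hM).
have := @sum_active _ (fun i => reK (projst X j i * conjK (gramst X j i))); rewrite e => h.
have fj : reK (projst X j j * conjK (gramst X j j)) = a X * x X.
  rewrite (nonneg_diag j (projst_nonneg X)) (nonneg_diag j (gramst_nonneg X)).
  by rewrite conjK_ofReal -rmorphM !reK_ofReal.
apply/eqP; rewrite -addr_eq0 addrC -fj -h // => i qi.
by rewrite projst_inactive // mul0r raddf0.
Qed.

Lemma sum_phases_const (c : R) : \sum_(w <- phasesK R k) c = beta * c.
Proof.
by rewrite big_const_seq count_predT iter_addr_0 size_phasesK mulr_natl.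
Qed.

(** Terms free of [w] are multiplied by the number of phases; products of two real parts become
    Hermitian products by [sum_phasesK]. *)
Lemma sum_phases_test_der X i : \sum_(w <- phasesK R k) test_der i w X =
  beta * ((reK (projst X i i) - a X) * x X) / pivot X +
  2 * reK (projst X j i * conjK (gramst X j i)) / pivot X -
  2 * x X * normK2 (projst X j i) / pivot X ^+ 2.
Proof.
transitivity (\sum_(w <- phasesK R k) (((reK (projst X i i) - a X) * x X) / pivot X +
    (2 / pivot X) * (reK (w * projst X j i) * reK (w * gramst X j i)) -
    (2 * x X / pivot X ^+ 2) * (reK (w * projst X j i) * reK (w * projst X j i)))).
  by apply: eq_bigr => w _; rewrite /test_der; ring.
rewrite sumrB big_split /= sum_phases_const -!mulr_sumr !sum_phasesK mul_conjK reK_ofReal.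
by ring.
Qed.

Lemma sum_active_const (c : R) : \sum_(i < n | (q < i < r)%N) c = ((r - q)%:R - 1) * c.
Proof.
transitivity (\sum_(q.+1 <= i < r) c).
  rewrite (big_nat_widen _ _ n) // (big_nat_widenl _ 0) // big_mkord.
  by apply: eq_bigl => i; rewrite andbC.
by rewrite sumr_const_nat -(subnSK qr) -natr1 addrK mulr_natl.
Qed.

Lemma sum_test_der X :
  \sum_(i < n | (q < i < r)%N) \sum_(w <- phasesK R k) test_der i w X =
  (beta * ((rtr (projst X) - (r - q)%:R * a X) * x X) - 2 * a X * x X) / pivot X -
  2 * x X * (a X - a X ^+ 2) / pivot X ^+ 2.
Proof.
transitivity (\sum_(i < n | (q < i < r)%N) ((beta * x X / pivot X) * reK (projst X i i)
    - beta * a X * x X / pivot X +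
    (2 / pivot X) * reK (projst X j i * conjK (gramst X j i)) -
    (2 * x X / pivot X ^+ 2) * normK2 (projst X j i))).
  by apply: eq_bigr => i _; rewrite sum_phases_test_der; ring.
rewrite !(sumrB, big_split) /= -!mulr_sumr sum_projst_row sum_projst_gramst sum_projst_diag.
by rewrite sum_active_const; ring.
Qed.

(** A quarter turn in the plane of [ev i] and [ev j], that is cosine [0] and sine [1], exchanges the
    two diagonal entries. *)
Lemma EE_gramst_diag (i : 'I_n) : (q < i < r)%N ->
  EE Omega (fun X => reK (gramst X i i)) = EE Omega (fun X => x X).
Proof.
move=> /andP[qi ir]; have ij : i != j by rewrite -val_eqE /= gtn_eqF.
have [|U [hU Uj Ui fU]] := @plane_rotation R k n i j 0 1 ij.
  by rewrite expr0n add0r normK2_phase // one_phasesK.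
have fixU (m : nat) : (m < q)%N || (r <= m)%N -> adj U *m ev m = ev m.
  move=> qm; rewrite -[X in _ *m X]fU ?mulmxA ?unitaryCK ?mul1mx //.
    by case/orP: qm => [mq|rm]; rewrite ?(ltn_eqF (ltn_trans mq qi)) // gtn_eqF // (leq_trans ir).
  case/orP: qm => [mq|rm]; first by rewrite /= (ltn_eqF mq).
  by rewrite /= gtn_eqF // (leq_trans qr).
have hU' := unitary_adj hU.
rewrite -[RHS](EE_unitary invariant hU' (bmeas_gramst_diag j)); congr EE; apply/funext => X.
have [_ hE] := state_equiv eps (X : 'M[K]_(n, l)) hU' fixU.
have -> : gramst (adj U *m (X : 'M[K]_(n, l))) = adj U *m gramst X *m adj (adj U).
  by rewrite /gramst hE gram_equiv.
rewrite -[in RHS]form_ev form_conj adjmxK Uj scale1r rmorph0 scale0r add0r.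
by rewrite form_ev.
Qed.

Let active : seq 'I_n := [seq i : 'I_n <- index_enum 'I_n | (q < i < r)%N].

(** The [r - q] active rows have equal expected norms; the other rows only add to the total. *)
Lemma EE_gramst_le : (r - q)%:R * EE Omega (fun X => x X) <=
  EE Omega (fun X => nrm2 (stE eps (X : 'M[K]_(n, l)) r q)).
Proof.
have [B [B0 hB]] := stE_bounded k n l r eps_gt0 q.
have mE : bmeas (fun X : MX => nrm2 (stE eps (X : 'M[K]_(n, l)) r q)).
  split; last by exists B => X; rewrite ger0_norm ?nrm2_ge0.
  by apply: measurable_nrm2; have [] := measmx_state k n l r q (ltW eps_gt0).
have mS (s : seq 'I_n) : bmeas (fun X => \sum_(i <- s) reK (gramst X i i)).
  by apply: bmeas_sum => i _; apply: bmeas_gramst_diag.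
have -> : (r - q)%:R * EE Omega (fun X => x X) =
    EE Omega (fun X => \sum_(i <- j :: active)
      reK (gramst X i i)).
  rewrite EE_sum => [|i _]; last exact: bmeas_gramst_diag.
  rewrite big_cons big_filter (eq_bigr (fun=> EE Omega (fun X => x X))) => [|i qir].
    by rewrite sum_active_const; ring.
  exact: EE_gramst_diag.
apply: EE_le => // X; rewrite big_cons big_filter nrm2_rows gramst_diagE [leRHS](bigD1 j) // lerD2l.
rewrite [leLHS]big_mkcond [leRHS]big_mkcond; apply: ler_sum => i _.
rewrite gramst_diagE; case: ifP => [/andP[qi _]|_]; first by rewrite -val_eqE /= gtn_eqF.
by case: ifP; rewrite ?nrm2_ge0.
Qed.

(** The sum of all derivatives has expectation zero and is bounded below pointwise by
    [stein_pointwise]; the term [(r - q) M_jj] is then absorbed into the trace of [M]. *)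
Lemma stein_bound (p : R) : {ae P, forall w, p <= rtr (projst (Omega w))} ->
  (beta * p - 2) * EE Omega (fun X => x X / pivot X) <=
  beta * EE Omega (fun X => nrm2 (stE eps (X : 'M[K]_(n, l)) r q)).
Proof.
move=> hp.
have mx := bmeas_gramst_diag j; have mi := bmeas_pivot_inv.
have mxi := bmeasM mx mi.
pose S X := \sum_(i <- active) \sum_(w <- phasesK R k) test_der i w X.
have mT i : bmeas (fun X => \sum_(w <- phasesK R k) test_der i w X).
  by apply: bmeas_sum => w /normK2_phase w1; apply: bmeas_test_der.
have mS : bmeas S by apply: bmeas_sum => i _; apply: mT.
have S0 : EE Omega S = 0.
  rewrite EE_sum => [|i _]; last exact: mT.
  rewrite big_filter big1 // => i qir; rewrite EE_sum => [|w /normK2_phase w1].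
    rewrite big1_seq // => w /andP[_ /normK2_phase w1].
    exact: EE_test_der.
  exact: bmeas_test_der.
have h : EE Omega (fun X => (beta * p - 2) * (x X / pivot X) - beta * (r - q)%:R * x X) <= 0.
  rewrite -S0; apply: EE_le_ae => //; first by apply: bmeasB; apply: bmeasZ.
  apply: filterS hp => w hw; rewrite /S big_filter sum_test_der /pivot.
  have /andP[a0 a1] := projst_diag (Omega w) j.
  have x0 := nonneg_diag_ge0 j (gramst_nonneg (Omega w)).
  exact: (stein_pointwise (2 - alphaK k) eps_gt0 x0 a0 a1 (ler0n R (r - q)) hw).
move: h; rewrite EEB ?EEZ // ?subr_le0; try exact: bmeasZ.
by move=> h; apply: le_trans h _; rewrite -mulrA ler_wpM2l //; apply: EE_gramst_le.
Qed.

End SteinSum.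

End SteinIdentity.

(** * Expected row norms of the oblique projectors *)

Section ExpectedRows.
Local Open Scope classical_set_scope.
Context (R : realType) (k : scalars) (n l : nat).
Local Notation K := (fieldK R k).
Local Notation adj := (@adjmx R k _ _).
Local Notation MX := (borelmx R k n l).
Local Notation ev := (@ev R k n).
Context (disp : measure_display) (T : measurableType disp) (P : probability T R).
Variable Omega : {RV P >-> MX}.
Hypothesis invariant : forall U : 'M[K]_n, is_unitaryK U ->
  eq_in_distribution P Omega (fun w => U *m (Omega w : 'M[K]_(n, l)) : MX).
Hypothesis full_rank : {ae P, forall w, \rank (Omega w : 'M[K]_(n, l)) = l}.
Variables (eps : R) (r : nat).
Hypotheses (eps_gt0 : 0 < eps) (rn : (r <= n)%N) (lr : (l <= r)%N).

Local Notation rowst q i :=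
  (fun X : MX => nrm2 (adj (ev i) *m stE eps (X : 'M[K]_(n, l)) r q)).
Local Notation enst q := (fun X : MX => nrm2 (stE eps (X : 'M[K]_(n, l)) r q)).
Local Notation pivst q :=
  (fun X : MX => nrm2 (stP eps (X : 'M[K]_(n, l)) r q *m ev q) + eps).

Lemma trace_ae q : {ae P, forall w, l%:R - q%:R <= rtr (stP eps (Omega w : 'M[K]_(n, l)) r q)}.
Proof.
have := coproj_trace_ae invariant (leq_trans lr rn) full_rank (leq_sub2l n lr).
rewrite subKn //; apply: filterS => w h.
apply: le_trans (stP_rtr eps (Omega w : 'M[K]_(n, l)) q rn); lra.
Qed.

Lemma bmeas_enst q : bmeas (enst q).
Proof.
have [B [B0 hB]] := stE_bounded k n l r eps_gt0 q.
split; last by exists B => X; rewrite ger0_norm ?nrm2_ge0.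
by apply: measurable_nrm2; have [] := measmx_state k n l r q (ltW eps_gt0).
Qed.

Lemma bmeas_rowst q (i : 'I_n) : bmeas (rowst q i).
Proof.
have [B [B0 hB]] := stE_bounded k n l r eps_gt0 q.
split; last first.
  exists B => X; rewrite ger0_norm ?nrm2_ge0 //.
  by apply: le_trans (hB X); apply: nrm2_row_le.
apply: measurable_nrm2; apply: measmx_M; first exact: measmx_cst.
by have [] := measmx_state k n l r q (ltW eps_gt0).
Qed.

(** This is [stein_bound] at [p = l - q]. With [beta = 2 - alpha] one has [2 / beta = 1 + alpha] in
    both cases, so dividing [beta * p - 2] by [beta] leaves [l - q - 1 - alpha]. *)
Lemma pivot_bound q (qn : (q < n)%N) (qr : (q < r)%N) :
  (q.+1 < l - alphaK k)%N ->
  bmeas (fun X => rowst q q X / pivst q X) /\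
  EE Omega (fun X => rowst q q X / pivst q X) * ((l - alphaK k)%:R - q%:R - 1) <=
  EE Omega (enst q).
Proof.
move=> ql.
have fE : (fun X : MX => rowst q q X / pivst q X) = (fun X : MX =>
    reK (gramst eps r q X (Ordinal qn) (Ordinal qn)) / pivot eps r qn X).
  apply/funext => X; rewrite gramst_diagE /pivot hproj_diag //; exact: stP_hproj.
split; rewrite fE.
  by apply: bmeasM; [apply: bmeas_gramst_diag|apply: bmeas_pivot_inv].
have := stein_bound invariant eps_gt0 qn rn qr (trace_ae q).
have al : (alphaK k <= l)%N by rewrite ltnW // -subn_gt0 (leq_trans _ ql).
rewrite (natrB _ al); set f := fun X : MX => _ / _.
move: (EE Omega f) (EE Omega (enst q)) => e E.
have [->|->] : alphaK k = 0%N \/ alphaK k = 1%N by case: (k); [right|left].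
  by rewrite subn0 mulr0n => h; lra.
by rewrite subn1 /= !mulr1n => h; lra.
Qed.

(** With [L = l - alpha], step [q] multiplies the expected squared norm by at most
    [(L - q) / (L - q - 1)]. The product with [L - q] is thus nonincreasing, and it starts at no
    more than [(r - l) * L]. *)
Lemma EE_enst_le q : (q < l - alphaK k)%N ->
  EE Omega (enst q) * ((l - alphaK k)%:R - q%:R) <= (r%:R - l%:R) * (l - alphaK k)%:R.
Proof.
have lL : (l - alphaK k <= l)%N by apply: leq_subr.
elim: q => [|q IH] ql.
  rewrite subr0 ler_wpM2r //.
  rewrite -[leRHS](EE_cst Omega); apply: EE_le_ae; [exact: bmeas_enst|exact: bmeas_cst|].
  have := coproj_trace_ae invariant (leq_trans lr rn) full_rank (leq_sub2l n lr).
  rewrite subKn //; apply: filterS => w h; rewrite stE0 nrm2_hproj //; exact: coproj_hproj.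
have qr : (q < r)%N by rewrite (leq_trans _ lr) // (leq_trans _ lL) // ltnW.
have qn : (q < n)%N by apply: leq_trans qr rn.
have [mx hx] := pivot_bound qn qr ql; have {}IH := IH (ltnW ql).
have step : EE Omega (enst q.+1) <= EE Omega (enst q) +
    EE Omega (fun X => rowst q q X / pivst q X).
  rewrite -EED //; last exact: bmeas_enst.
  apply: EE_le; [exact: bmeas_enst|by apply: bmeasD => //; apply: bmeas_enst|move=> X].
  rewrite stE_nrm2 lerD2l; set a := nrm2 (_ *m ev q); set x := nrm2 (adj _ *m _).
  have a0 : 0 <= a by apply: nrm2_ge0.
  have ae : 0 < a + eps by rewrite ltr_wpDl.
  rewrite expr2 invfM mulrA ler_wpM2r ?invr_ge0 ?(ltW ae) // mulrAC ler_piMl ?nrm2_ge0 //.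
  by rewrite ler_pdivrMr // mul1r lerDl ltW.
rewrite -natr1 in hx *; set L := (l - alphaK k)%:R in IH hx *.
have Lq : 1 <= L - q%:R - 1.
  by rewrite -addrA -opprD natr1 /L -natrB 1?ltnW // ler1n subn_gt0.
move: step IH hx; set e1 := EE _ (enst q.+1); set e0 := EE _ (enst q); set e := EE _ _.
move=> step IH hx; apply: le_trans IH.
have -> : e0 * (L - q%:R) = e0 * (L - (q%:R + 1)) + e0 by ring.
apply: le_trans (_ : (e0 + e) * (L - (q%:R + 1)) <= _).
  by apply: ler_wpM2r => //; lra.
by rewrite mulrDl lerD2l; have -> : L - (q%:R + 1) = L - q%:R - 1 by ring.
Qed.

Lemma EE_row_active q (i : 'I_n) : (q < l - alphaK k)%N -> (q <= i < r)%N ->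
  EE Omega (rowst q i) <=
  (r%:R - l%:R) / (r%:R - q%:R) * ((l - alphaK k)%:R / ((l - alphaK k)%:R - q%:R)).
Proof.
move=> ql /andP[qi ir]; have qr : (q < r)%N by apply: leq_ltn_trans ir.
have qn : (q < n)%N by apply: leq_trans qr rn.
have hE := EE_enst_le ql; have hG := EE_gramst_le invariant eps_gt0 qn rn qr.
have -> : EE Omega (rowst q i) =
    EE Omega (fun X => reK (gramst eps r q X (Ordinal qn) (Ordinal qn))).
  have [e|iq] := eqVneq i (Ordinal qn).
    by rewrite e; congr EE; apply/funext => X; rewrite gramst_diagE.
  rewrite -(EE_gramst_diag invariant eps_gt0 qn qr (i := i)).
    by congr EE; apply/funext => X; rewrite gramst_diagE.
  by rewrite ir andbT ltn_neqAle qi andbT eq_sym.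
set x := EE _ _ in hG *; have Lq : 0 < (l - alphaK k)%:R - q%:R :> R by rewrite subr_gt0 ltr_nat.
have rq : 0 < r%:R - q%:R :> R by rewrite subr_gt0 ltr_nat.
rewrite mulf_div ler_pdivlMr ?mulr_gt0 // mulrA; apply: le_trans hE.
by rewrite ler_wpM2r ?(ltW Lq) // mulrC -natrB // ltnW.
Qed.

Lemma rowst_frozen q s i (X : MX) : (i < q)%N -> rowst (q + s) i X = rowst q i X.
Proof.
move=> iq; elim: s => [|s IH]; first by rewrite addn0.
by rewrite addnS stE_row_keep ?IH // (leq_trans iq) // leq_addr.
Qed.

(** Once treated, row [i] is never modified again. Its squared norm is then at most [eps] times the
    quotient of [pivot_bound], whose expectation is bounded independently of [eps]. *)
Lemma EE_row_frozen q (i : 'I_n) : (q < l - alphaK k)%N -> (i < q)%N ->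
  EE Omega (rowst q i) <= eps * ((r%:R - l%:R) * (l - alphaK k)%:R).
Proof.
move=> ql iq; have il : (i.+1 < l - alphaK k)%N by apply: leq_ltn_trans ql.
have lL : (l - alphaK k <= l)%N by apply: leq_subr.
have ir : (i < r)%N by rewrite (leq_trans _ lr) // (leq_trans _ lL) // ltnW.
have [mx hx] := pivot_bound (ltn_ord i) ir il.
have -> : EE Omega (rowst q i) = EE Omega (rowst i.+1 i).
  congr EE; apply/funext => X; rewrite -(subnKC iq).
  exact: (rowst_frozen (q - i.+1) X (ltnSn i)).
apply: (@le_trans _ _ (EE Omega (fun X => eps * (rowst i i X / pivst i X)))).
  apply: EE_le; [exact: bmeas_rowst|exact: bmeasZ|move=> X].
  rewrite stE_row_new // nrm2Z normK2_ofReal.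
  set a := nrm2 (_ *m ev i); set x := nrm2 (adj _ *m _).
  have a0 : 0 <= a by apply: nrm2_ge0.
  have x0 : 0 <= x by apply: nrm2_ge0.
  have ae : 0 < a + eps by rewrite ltr_wpDl.
  have -> : (eps / (a + eps)) ^+ 2 * x = eps * (x / (a + eps)) * (eps / (a + eps)).
    by field; rewrite gt_eqF.
  rewrite ler_piMr ?mulr_ge0 ?invr_ge0 ?(ltW eps_gt0) ?(ltW ae) //.
  by rewrite ler_pdivrMr // mul1r lerDr.
rewrite EEZ // ler_wpM2l ?(ltW eps_gt0) //.
have e_ge0 : 0 <= EE Omega (fun X => rowst i i X / pivst i X).
  by apply: EE_ge0 => X; rewrite divr_ge0 ?addr_ge0 ?nrm2_ge0 ?(ltW eps_gt0).
have E_ge0 : 0 <= EE Omega (enst i) by apply: EE_ge0 => X; apply: nrm2_ge0.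
have hE := EE_enst_le (ltnW il).
set L := (l - alphaK k)%:R in hx hE *.
have Lq : 1 <= L - i%:R - 1.
  by rewrite -addrA -opprD natr1 /L -natrB 1?ltnW // ler1n subn_gt0.
apply: le_trans hE; apply: (@le_trans _ _ (EE Omega (enst i))).
  by apply: le_trans hx; rewrite ler_peMr.
by rewrite ler_peMr //; lra.
Qed.

(** Rows of index below [q] are of order [eps], and the rows from [q] to [r - 1] share the same
    bound. *)
Lemma EE_weighted_rows q (sigma : nat -> R) : (q < l - alphaK k)%N ->
  (forall i, 0 <= sigma i) ->
  EE Omega (fun X => \sum_(i < n | (i < r)%N) sigma i * rowst q i X) <=
  (r%:R - l%:R) / (r%:R - q%:R) * ((l - alphaK k)%:R / ((l - alphaK k)%:R - q%:R)) *
    (\sum_(i < n | (q <= i < r)%N) sigma i) +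
  eps * ((r%:R - l%:R) * (l - alphaK k)%:R * \sum_(i < n | (i < r)%N) sigma i).
Proof.
move=> ql s0.
have -> : (fun X => \sum_(i < n | (i < r)%N) sigma i * rowst q i X) =
    (fun X => \sum_(i <- [seq i : 'I_n <- index_enum 'I_n | (i < r)%N]) sigma i * rowst q i X).
  by apply/funext => X; rewrite big_filter.
have mr (i : 'I_n) : bmeas (fun X => sigma i * rowst q i X) by apply/bmeasZ/bmeas_rowst.
rewrite EE_sum // big_filter.
set A := _ / _ * (_ / _); set B := _ * (l - alphaK k)%:R.
have B0 : 0 <= B by rewrite mulr_ge0 // subr_ge0 ler_nat.
rewrite mulrA !mulr_sumr [X in X + _]big_mkcond [X in _ + X]big_mkcond [leLHS]big_mkcond /=.
rewrite -big_split /=; apply: ler_sum => i _.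
case: ifP => [ir|]; last by rewrite andbF addr0.
rewrite andbT EEZ; last exact: bmeas_rowst.
case: leqP => qi; last by rewrite add0r mulrC ler_wpM2r // EE_row_frozen.
apply: (@le_trans _ _ (A * sigma i)).
  by rewrite mulrC ler_wpM2r // EE_row_active ?qi.
by rewrite lerDl mulr_ge0 // mulr_ge0 // ltW.
Qed.

End ExpectedRows.

(** * The randomized SVD error *)

Section Projection.
Context (R : realType) (k : scalars).
Local Notation K := (fieldK R k).
Local Notation adj := (@adjmx R k _ _).
Local Notation conj := (@conjK R k).

(** The dimensions add up to [m]. A common vector [v = y F^T] with [v conj(F) = 0] has
    [v v* = v conj(F) y* = 0]. *)
Lemma range_kernel_full m p (F : 'M[K]_(m, p)) :
  (1%:M <= <<F^T>> + kermx (map_mx conj F))%MS.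
Proof.
rewrite sub1mx -col_leq_rank mxrank_disjoint_sum.
  by rewrite genmxE mxrank_tr mxrank_ker mxrank_map subnKC // rank_leq_row.
apply/eqP/rowV0P => v; rewrite sub_capmx genmxE => /andP[/submxP[y vy] /sub_kermxP vF].
apply: nrm2_eq0; rewrite nrm2E {2}vy adjmxM.
have -> : adj F^T = map_mx conj F by rewrite /adjmx trmxK.
by rewrite mulmxA vF mul0mx !raddf0.
Qed.

Lemma orthoproj_range m p (F : 'M[K]_(m, p)) : exists W, orthoproj F = F *m W.
Proof.
have : (proj_mx <<F^T>> (kermx (map_mx conj F)) <= F^T)%MS.
  by rewrite -[proj_mx _ _]mul1mx (submx_trans (proj_mx_sub _ _ _)) // genmxE.
move=> /submxP[W hW]; exists W^T.
by rewrite /orthoproj hW trmx_mul trmxK.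
Qed.

Lemma orthoproj_orth m p (F : 'M[K]_(m, p)) : adj F *m (1%:M - orthoproj F) = 0.
Proof.
have /sub_kermxP h := proj_mx_compl_sub (range_kernel_full F).
apply: trmx_inj; rewrite trmx_mul trmx0 -[RHS]h raddfB /= trmx1 /orthoproj trmxK mul1mx.
by congr (_ *m _); rewrite /adjmx -map_trmx trmxK.
Qed.

(** Pythagoras: the residual is orthogonal to the range of [F], which contains the columns of the
    other summand. *)
Lemma orthoproj_best m p n (F : 'M[K]_(m, p)) (A : 'M[K]_(m, n)) Z :
  nrm2 (A - orthoproj F *m A) <= nrm2 (A - F *m Z).
Proof.
have [W hW] := orthoproj_range F.
have -> : A - F *m Z = (A - orthoproj F *m A) + (orthoproj F *m A - F *m Z).
  by rewrite addrA subrK.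
rewrite [leRHS]nrm2D_orth ?lerDl ?nrm2_ge0 //.
have -> : A - orthoproj F *m A = (1%:M - orthoproj F) *m A by rewrite mulmxBl mul1mx.
have -> : orthoproj F *m A - F *m Z = F *m (W *m A - Z) by rewrite hW -mulmxA -mulmxBr.
have e : adj (1%:M - orthoproj F) *m F = 0.
  by rewrite -{2}(adjmxK F) -adjmxM orthoproj_orth adjmx0.
by rewrite adjmxM mulmxA -(mulmxA (adj A)) e mulmx0 mul0mx.
Qed.

End Projection.

(** * Singular values, truncation and the error of the randomized approximation *)

Section DiagonalMatrices.
Context (R : realType) (k : scalars) (d n : nat).
Local Notation K := (fieldK R k).
Local Notation "x %:K" := (@ofRealK R k x) (at level 2, format "x %:K").
Local Notation adj := (@adjmx R k _ _).
Local Notation ev := (@ev R k n).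
Local Notation D s := (rect_diag k d n s).

Lemma rect_diag_row (s : nat -> R) p (E : 'M[K]_(n, p)) (a : 'I_d) :
  row a (D s *m E) = (s a)%:K *: (adj (ev a) *m E).
Proof.
apply/rowP => b; rewrite !mxE mulr_sumr; apply: eq_bigr => i _.
rewrite !mxE eq_sym; case: eqP => _; rewrite ?rmorph1 ?rmorph0 ?mul1r ?mul0r ?mulr0 //.
Qed.

Lemma rect_diag_nrm2 (s : nat -> R) r p (E : 'M[K]_(n, p)) :
  (r <= d)%N -> (r <= n)%N ->
  (forall i, (r <= i)%N -> (i < d)%N -> (i < n)%N -> s i = 0) ->
  nrm2 (D s *m E) = \sum_(i < n | (i < r)%N) s i ^+ 2 * nrm2 (adj (ev i) *m E).
Proof.
move=> rd rn s0; pose f (i : nat) := s i ^+ 2 * nrm2 (adj (ev i) *m E).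
rewrite -(big_ord_widen n f rn) (big_ord_widen d f rd) [RHS]big_mkcond.
apply: eq_bigr => a _; have -> : \sum_j normK2 ((D s *m E) a j) = nrm2 (row a (D s *m E)).
  by rewrite /nrm2 big_ord_recl big_ord0 addr0; apply: eq_bigr => j _; rewrite [in RHS]mxE.
rewrite rect_diag_row nrm2Z normK2_ofReal; case: ltnP => // ra.
have [an|na] := ltnP a n; first by rewrite (s0 a) // expr0n mul0r.
by rewrite ev_oob // adjmx0 mul0mx nrm2_0 mulr0.
Qed.

Lemma rect_diag_ev (s : nat -> R) r :
  (forall i, (r <= i)%N -> (i < d)%N -> (i < n)%N -> s i = 0) ->
  forall i, (r <= i)%N -> D s *m ev i = 0.
Proof.
move=> s0 i ri; have [ni|lin] := leqP n i; first by rewrite ev_oob // mulmx0.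
rewrite (mulmx_evE _ (Ordinal lin)); apply/colP => a; rewrite !mxE.
case: eqP => //= ai; rewrite ai s0 ?rmorph0 //; by rewrite -ai.
Qed.

(** The leading square block of size [i.+1] is diagonal with nonzero entries, hence invertible. *)
Lemma rank_rect_diag (s : nat -> R) i :
  (i < d)%N -> (i < n)%N -> (forall j, (j <= i)%N -> s j != 0) -> (i < \rank (D s))%N.
Proof.
move=> id lin s0.
pose f (a : 'I_i.+1) : 'I_d := widen_ord id a; pose g (a : 'I_i.+1) : 'I_n := widen_ord lin a.
have fgE : (rowsub g (rowsub f (D s))^T)^T = diag_mx (\row_(a < i.+1) (s a)%:K).
  apply/matrixP => a b; rewrite !mxE /=.
  by case: (a =P b) => [->|/eqP ab]; rewrite ?eqxx ?mulr1n // val_eqE (negbTE ab) mulr0n.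
apply: leq_trans (mxrankS (rowsub_sub f _)); rewrite -[X in (_ <= X)%N]mxrank_tr.
apply: leq_trans (mxrankS (rowsub_sub g _)); rewrite -[X in (_ <= X)%N]mxrank_tr fgE.
rewrite mxrank_unit // unitmxE det_diag unitfE; apply/prodf_neq0 => a _.
by rewrite mxE fmorph_eq0 s0 // -ltnS.
Qed.

(** A nonzero [s i] makes all earlier values nonzero by monotonicity, so the diagonal factor would
    have rank above [i]; but that factor is [U* A V]. *)
Lemma svd_vanish (A : 'M[K]_(d, n)) U s V : is_svd A U s V ->
  forall i, (\rank A <= i)%N -> (i < d)%N -> (i < n)%N -> s i = 0.
Proof.
move=> [hU hV s0 sdec hA] i ri id lin; apply/eqP; apply: contraT => si.
have : (i < \rank (D s))%N.
  apply: rank_rect_diag => // j ji; rewrite gt_eqF // (lt_le_trans _ (sdec _ _ ji)) //.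
  by rewrite lt_def si s0.
have -> : D s = adj U *m (A *m V).
  by rewrite hA -!mulmxA unitaryCK // mulmx1 mulmxA unitaryCK // mul1mx.
move=> h; have := leq_trans h (mxrankM_maxr _ _).
by move=> {}h; have := leq_trans h (mxrankM_maxl _ _); rewrite ltnNge ri.
Qed.

Lemma truncated_svd_nrm2 (A B : 'M[K]_(d, n)) U s V q :
  is_svd A U s V ->
  B = U *m rect_diag k d n (fun i => if (i < q)%N then s i else 0) *m adj V ->
  nrm2 (A - B) = \sum_(i < n | (q <= i < \rank A)%N) s i ^+ 2.
Proof.
move=> hsvd ->; have s0 := svd_vanish hsvd; have [hU hV _ _ hA] := hsvd.
rewrite {1}hA -mulmxBl -mulmxBr nrm2_unitaryr; last exact: unitary_adj.
rewrite nrm2_unitaryl // -[_ - _]mulmx1.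
have -> : D s - D (fun i => if (i < q)%N then s i else 0) =
    D (fun i => if (i < q)%N then 0 else s i).
  apply/matrixP => a b; rewrite !mxE; case: eqP => _; last by rewrite subr0.
  by case: ifP; rewrite ?rmorph0 ?subrr ?subr0.
rewrite (@rect_diag_nrm2 _ (\rank A)) ?rank_leq_row ?rank_leq_col // => [|i ri id lin].
  rewrite [LHS]big_mkcond [RHS]big_mkcond; apply: eq_bigr => i _.
  by rewrite mulmx1 nrm2_adj nrm2_ev mulr1; case: ltnP => _; case: leqP => //= _; rewrite expr0n.
by case: ifP => // _; apply: s0.
Qed.

(** Projection onto the range of [A Om] is at least as good as the competitor [A Om Z V*]. With
    [X = V* Om] and [Z] chosen so that [D X Z = D (1 - E)], the competitor leaves the error
    [U D E V*]. *)
Lemma svd_error_le l (A : 'M[K]_(d, n)) U s V (Om : 'M[K]_(n, l)) (eps : R) q :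
  is_svd A U s V ->
  nrm2 (A - orthoproj (A *m Om) *m A) <=
  \sum_(i < n | (i < \rank A)%N)
    s i ^+ 2 * nrm2 (adj (ev i) *m stE eps (adj V *m Om) (\rank A) q).
Proof.
move=> hsvd; have s0 := svd_vanish hsvd; have [hU hV _ _ hA] := hsvd.
have [Z hZ] := stE_range eps (adj V *m Om) q (rect_diag_ev s0).
rewrite -(@rect_diag_nrm2 s (\rank A)) ?rank_leq_row ?rank_leq_col //.
set E := stE _ _ _ _ in hZ *.
apply: (le_trans (orthoproj_best _ _ (Z *m adj V))).
have -> : A - A *m Om *m (Z *m adj V) = U *m (D s *m E) *m adj V.
  have -> : A *m Om *m (Z *m adj V) = U *m (D s *m (adj V *m Om) *m Z) *m adj V.
    by rewrite {1}hA !mulmxA.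
  by rewrite -hZ mulmxBr mulmx1 mulmxBr mulmxBl -{1}hA opprB addrC subrK.
by rewrite nrm2_unitaryr ?nrm2_unitaryl //; apply: unitary_adj.
Qed.

End DiagonalMatrices.

Section IntegralMonotone.
Local Open Scope classical_set_scope.
Local Open Scope ereal_scope.
Context d (T : measurableType d) (R : realType) (mu : {measure set T -> \bar R}).

(* The integral of a nonnegative function is a supremum over the simple functions
   below it. *)
Lemma ge0_le_integral_nonmeasurable (f g : T -> \bar R) :
  (forall x, 0 <= f x) -> (forall x, f x <= g x) ->
  \int[mu]_x f x <= \int[mu]_x g x.
Proof.
move=> f0 fg; have g0 x : 0 <= g x by apply: le_trans (fg x).
rewrite !ge0_integralTE //; apply: ereal_sup_le => _ [h hf <-].
by exists h => // x; apply: le_trans (fg x).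
Qed.

End IntegralMonotone.

Theorem theorem3p2 (R : realType) (k : scalars) (d n l : nat)
    (disp : measure_display) (T : measurableType disp) (P : probability T R)
    (Omega : {RV P >-> borelmx R k n l})
    (d_gt0 : (0 < d)%N) (n_gt0 : (0 < n)%N) (l_gt0 : (0 < l)%N)
    (le_ln : (l <= n)%N)
    (full_rank : {ae P, forall w, \rank (Omega w : 'M[fieldK R k]_(n, l)) = l})
    (invariant : forall U : 'M[fieldK R k]_n, is_unitaryK U ->
      eq_in_distribution P Omega
        (fun w => U *m (Omega w : 'M[fieldK R k]_(n, l)) : borelmx R k n l))
    (A : 'M[fieldK R k]_(d, n)) (r : nat)
    (rankA : r = \rank A) (le_lr : (l <= r)%N)
    (truncA : nat -> 'M[fieldK R k]_(d, n))
    (truncAP : forall q, (q < l - alphaK k)%N ->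
      is_truncated_svd q A (truncA q)) :
  ('E_P[fun w => (frobenius
    (A - orthoproj (A *m (Omega w : 'M[fieldK R k]_(n, l))) *m A) ^+ 2)%R]
   <= \big[mine/+oo]_(q < l - alphaK k)
        ((r%:R - l%:R) / (r%:R - q%:R)
         * (1 + q%:R / (l%:R - q%:R - (alphaK k)%:R))
         * frobenius (A - truncA q) ^+ 2)%:E)%E.
Proof.
apply: le_bigmin => [|q _]; first exact: leey.
(* For each [q], the argument runs in the singular bases that come with [truncA q]. *)
have [U [s [V [hsvd hB]]]] := truncAP q (ltn_ord q).
have [_ hV _ _ _] := hsvd; have hV' := unitary_adj hV.
have rn : (r <= n)%N by rewrite rankA rank_leq_col.
rewrite frobenius_sqr (truncated_svd_nrm2 hsvd hB) -rankA.
have s0 i : 0 <= s i ^+ 2 by apply: sqr_ge0.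
set C := (r%:R - l%:R) * (l - alphaK k)%:R * \sum_(i < n | (i < r)%N) s i ^+ 2.
have C0 : 0 <= C.
  by rewrite mulr_ge0 ?sumr_ge0 // mulr_ge0 // subr_ge0 ler_nat.
(* It is enough to prove the bound up to any [e > 0]. The regularization costs [eps * C], and the
   [+ 1] covers the case [C = 0]. *)
apply/lee_addgt0Pr => e e0; pose eps := e / (C + 1).
have eps0 : 0 < eps by rewrite divr_gt0 // ltr_wpDl.
have eC : eps * C <= e.
  by rewrite /eps mulrAC ler_pdivrMr ?ltr_wpDl // ler_wpM2l ?(ltW e0) // lerDl.
have := EE_weighted_rows invariant full_rank eps0 rn le_lr (ltn_ord q) s0.
set g := fun X : borelmx R k n l => _; rewrite -/C => hg.
have mg : bmeas g.
  have -> : g = (fun X => \sum_(i <- [seq i : 'I_n <- index_enum 'I_n | (i < r)%N])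
      s i ^+ 2 * nrm2 (adjmx (ev R k n i) *m stE eps (X : 'M[fieldK R k]_(n, l)) r q)).
    by apply/funext => X; rewrite big_filter.
  by apply: bmeas_sum => i _; apply/bmeasZ/bmeas_rowst.
have mgV := bmeas_unitary (adjmx V) mg.
apply: (@le_trans _ _ (EE Omega (fun X => g (adjmx V *m (X : 'M[fieldK R k]_(n, l)))))%:E).
  rewrite unlock /EE /Rintegral fineK; last first.
    exact: (integrable_fin_num measurableT (bmeas_integrable Omega mgV)).
  (* Only the majorant has been shown measurable, so a comparison free of measurability conditions
     is used for the error itself. *)
  apply: ge0_le_integral_nonmeasurable => w; rewrite lee_fin ?sqr_ge0 //.
  rewrite frobenius_sqr /g rankA; exact: (svd_error_le _ _ _ hsvd).
(* Invariance removes the factor [V*] in front of [Omega]. *)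
rewrite (EE_unitary invariant hV' mg) -EFinD lee_fin (le_trans hg) // lerD //.
(* The two constants agree: [1 + q / (l - q - alpha) = (l - alpha) / (l - alpha - q)]. *)
rewrite le_eqVlt; apply/orP; left; apply/eqP; congr (_ * _ * _).
have aL : (alphaK k <= l)%N by rewrite ltnW // -subn_gt0 (leq_ltn_trans _ (ltn_ord q)).
have lq : (l - alphaK k)%:R - q%:R != 0 :> R.
  by rewrite subr_eq0 eqr_nat gtn_eqF // ltn_ord.
move: lq; rewrite natrB // => lq; field.
by move: lq; rewrite addrAC.
Qed.
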